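(* Let $m,n\ge1$ and let $H_{m,n}$ be the complete bipartite graph on $m+n$ vertices. The integral $I_{H_{m,n}}(\delta,\mathbb{I}_{m+n})$ converges absolutely for all $\delta>-1$, and $$ I_{H_{m,n}}(\delta, \mathbb{I}_{m+n}) = \big[\Gamma\big(\delta + \tfrac12 n +1\big)\big]^m \, \big[\Gamma(\delta+\tfrac12 m +1)\big]^n \cdot\frac{\Gamma_{m+n}\big(\delta+\tfrac12(m+n+1)\big)}{\Gamma_m\big(\delta + \tfrac12(m+n+1)\big) \, \Gamma_n\big(\delta+\tfrac12(m+n+1)\big)}. $$
   Context: $\mathbb{S}^p_{\succ0}$ is the cone of real symmetric positive definite $p\times p$ matrices. For an undirected graph $G=(V,E)$ on $V=\{1,\dots,p\}$, $\mathbb{S}^p_{\succ0}(G)=\{M\in\mathbb{S}^p_{\succ0}\mid M_{ij}=0\text{ for all distinct } i,j \text{ with }(i,j)\notin E\}$. For $D\in\mathbb{S}^p_{\succ0}$, $$I_G(\delta,D)=\int_{\mathbb{S}^p_{\succ0}(G)}|K|^{\delta}\exp(-\mathrm{tr}(KD))\,dK,\qquad dK=\prod_{i=1}^p dk_{ii}\prod_{i<j,\,(i,j)\in E}dk_{ij},$$ with $|K|=\det K$. $\mathbb{I}_p$ is the $p\times p$ identity matrix. The complete bipartite graph $H_{m,n}$ has vertex set $U\cup V$ with $U=\{1,\dots,m\}$, $V=\{m+1,\dots,m+n\}$; each vertex of $U$ is joined to every vertex of $V$, and there are no edges within $U$ or within $V$. The multivariate gamma function is $\Gamma_p(\alpha)=\pi^{p(p-1)/4}\prod_{i=1}^p\Gamma(\alpha-\tfrac12(i-1))$.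 *)

(* Defs.v *)
From HB Require Import structures.
From mathcomp Require Import all_boot all_order all_algebra.
From mathcomp Require Import all_classical all_reals all_analysis.

Set Implicit Arguments.
Unset Strict Implicit.
Unset Printing Implicit Defensive.

Import Order.TTheory GRing.Theory Num.Theory.
Import numFieldNormedType.Exports.

Local Open Scope classical_set_scope.
Local Open Scope ring_scope.

(* Lebesgue measure on R^n, as the n-fold product of the Lebesgue measure
   on R; the sigma-algebra on n.-tuple is the product one. *)
Section lebesgue_tuple.
Context {R : realType}.
Local Notation RT := (measurableTypeR R).

Definition pair_cons k (xt : RT * k.-tuple RT) : k.+1.-tuple RT :=
  cons_tuple xt.1 xt.2.

Fixpoint lebesgue_tuple (n : nat) : set (n.-tuple RT) -> \bar R :=
  match n return set (n.-tuple RT) -> \bar R with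
  | 0 => \d_([tuple] : 0.-tuple RT)
  | k.+1 => pushforward (lebesgue_measure \x @lebesgue_tuple k)%E (@pair_cons k)
  end.

Let measurable_pair_cons k :
  measurable_fun [set: RT * k.-tuple RT] (@pair_cons k).
Proof. exact: (measurable_cons measurable_fst measurable_snd). Qed.

Let uncons k (v : k.+1.-tuple RT) : RT * k.-tuple RT :=
  (thead v, [tuple of behead v]).

Let measurable_uncons k : measurable_fun [set: k.+1.-tuple RT] (@uncons k).
Proof.
by apply: measurable_fun_pair;
  [exact: measurable_tnth|exact: measurable_behead].
Qed.

Let consK k : cancel (@pair_cons k) (@uncons k).
Proof. by case=> x t; rewrite /uncons/= theadE; congr pair; exact/val_inj. Qed.

Let lebesgue_tuple_measure n :
  exists mu : {sigma_finite_measure set (n.-tuple RT) -> \bar R},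
    @lebesgue_tuple n = mu.
Proof.
elim: n => [|k [mu muE]] /=; first by exists (\d_([tuple] : 0.-tuple RT)).
rewrite muE.
pose nu : {measure set (k.+1.-tuple RT) -> \bar R} :=
  measure_function_pushforward__canonical__measure_function_Measure
    (lebesgue_measure \x mu)%E (@measurable_pair_cons k).
have nu_sfin : sigma_finite setT nu.
  have /sigma_finiteP[A [TA ndA Afin]] := sigma_finiteT (@lebesgue_measure R).
  have /sigma_finiteP[B [TB ndB Bfin]] := sigma_finiteT mu.
  exists (fun i => @uncons k @^-1` (A i `*` B i)).
    apply/esym; rewrite -preimage_bigcup -subTset => v _.
    have [i _ Ai] : (\bigcup_i A i) (uncons v).1 by rewrite -TA.
    have [j _ Bj] : (\bigcup_i B i) (uncons v).2 by rewrite -TB.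
    exists (maxn i j) => //; split.
      by move: Ai; exact/subsetPset/ndA/leq_maxl.
    by move: Bj; exact/subsetPset/ndB/leq_maxr.
  move=> i; have [mA Afoo] := Afin i; have [mB Bfoo] := Bfin i; split.
    rewrite -[X in measurable X]setTI; apply: measurable_uncons => //.
    exact: measurableX.
  rewrite /nu/= /pushforward -comp_preimage (_ : _ \o _ = id) ?preimage_id//.
    by rewrite product_measure1E// lte_mul_pinfty// ge0_fin_numE.
  by apply/funext => xt /=; rewrite consK.
pose nusf := Measure_isSigmaFinite.Build _ _ _ (nu : set _ -> \bar R) nu_sfin.
by exists (HB.pack_for {sigma_finite_measure set (k.+1.-tuple RT) -> \bar R}
  (nu : set _ -> \bar R) (Measure.class nu) nusf).
Qed.

Variable n : nat.

Let lebesgue_tuple0 : @lebesgue_tuple n set0 = 0%E.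
Proof. by have [mu ->] := lebesgue_tuple_measure n; exact: measure0. Qed.

Let lebesgue_tuple_ge0 A : (0 <= @lebesgue_tuple n A)%E.
Proof. by have [mu ->] := lebesgue_tuple_measure n; exact: measure_ge0. Qed.

Let lebesgue_tuple_sigma_additive : semi_sigma_additive (@lebesgue_tuple n).
Proof.
have [mu ->] := lebesgue_tuple_measure n; exact: measure_semi_sigma_additive.
Qed.

HB.instance Definition _ := isMeasure.Build _ _ _ (@lebesgue_tuple n)
  lebesgue_tuple0 lebesgue_tuple_ge0 lebesgue_tuple_sigma_additive.

Let lebesgue_tuple_sigma_finite : sigma_finite setT (@lebesgue_tuple n).
Proof. by have [mu ->] := lebesgue_tuple_measure n; exact: sigma_finiteT. Qed.

HB.instance Definition _ := Measure_isSigmaFinite.Build _ _ _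
  (@lebesgue_tuple n) lebesgue_tuple_sigma_finite.

End lebesgue_tuple.
Arguments lebesgue_tuple {R} n _.

(* The argument of the Gamma functions is only meaningful when it is > 0. *)
Definition Gamma {R : realType} (a : R) : R :=
  \int[lebesgue_measure]_(t in `]0, +oo[) (t `^ (a - 1) * expR (- t)).

(* i ranges over 0, ..., p - 1, hence i / 2 instead of (i - 1) / 2 *)
Definition multi_Gamma {R : realType} (p : nat) (a : R) : R :=
  pi `^ (p%:R * (p%:R - 1) / 4) * \prod_(i < p) Gamma (a - i%:R / 2).

Record sgraph (p : nat) := SGraph {
  edge :> rel 'I_p;
  edge_sym : symmetric edge;
  edge_irrefl : irreflexive edge }.

Definition bip_edge (m n : nat) : rel 'I_(m + n) :=
  fun i j => (i < m)%N != (j < m)%N.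

Lemma bip_edge_sym m n : symmetric (@bip_edge m n).
Proof. by move=> i j; rewrite /bip_edge eq_sym. Qed.

Lemma bip_edge_irrefl m n : irreflexive (@bip_edge m n).
Proof. by move=> i; rewrite /bip_edge eqxx. Qed.

Definition complete_bipartite (m n : nat) : sgraph (m + n) :=
  SGraph (@bip_edge_sym m n) (@bip_edge_irrefl m n).

Section graph_integral.
Context {R : realType} {p : nat}.
Variable G : sgraph p.
Implicit Types (K D : 'M[R]_p) (d : R).

Definition posdefmx K : Prop :=
  K^T = K /\ forall v : 'cV[R]_p, v != 0 -> 0 < (v^T *m K *m v) 0 0.

Definition posdef_graph : set 'M[R]_p :=
  [set K | posdefmx K /\ forall i j, i != j -> ~~ G i j -> K i j = 0].

(* indices of the free entries: the diagonal, and the edges (i, j), i < j *)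
Definition graph_coord : {set 'I_p * 'I_p} :=
  [set ij : 'I_p * 'I_p | (ij.1 == ij.2) || (ij.1 < ij.2)%N && G ij.1 ij.2].

(* The symmetric matrix with the given free entries. When (i, j) is not a free
   entry, index returns the length of x, so that nth returns the default 0. *)
Definition graph_mx (x : #|graph_coord|.-tuple (measurableTypeR R)) : 'M[R]_p :=
  \matrix_(i, j)
    nth (0 : R) x (index (if (i <= j)%N then (i, j) else (j, i))
                         (enum graph_coord)).

Definition graph_integrand d D K : R := (\det K) `^ d * expR (- \tr (K *m D)).

(* The integral over posdef_graph with respect to dK is the one over its
   preimage in the space of free entries with respect to Lebesgue measure. *)
Definition graph_integral d D : \bar R :=
  \int[lebesgue_tuple #|graph_coord|]_(x in graph_mx @^-1` posdef_graph)
    (graph_integrand d D (graph_mx x))%:E.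

Definition graph_integral_cvg d D : Prop :=
  (lebesgue_tuple #|graph_coord|).-integrable (graph_mx @^-1` posdef_graph)
    (fun x => (graph_integrand d D (graph_mx x))%:E).

End graph_integral.
Arguments graph_mx {R p} G x.

(* Main.v *)
Require Import Defs.
From mathcomp Require Import all_boot all_order all_algebra.
From mathcomp Require Import all_classical all_reals all_analysis.
From mathcomp Require Import measurable_realfun ring lra.

Set Implicit Arguments.
Unset Strict Implicit.
Unset Printing Implicit Defensive.

Import Order.TTheory GRing.Theory Num.Theory.
Import numFieldNormedType.Exports.

Local Open Scope classical_set_scope.
Local Open Scope ring_scope.

(* Write [K] in blocks as [[diag a, B], [B^T, diag b]], with columns [x_j] of
   [B]. The Schur complement gives
   [det K = prod_j b_j * det (diag a - sum_j x_j x_j^T / b_j)], so it suffices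
   to integrate out one column at a time:
   [int det (P - x x^T / b)^d dx = c_m(d) b^(m/2) (det P)^(d + 1/2)],
   where [P] is positive definite and the determinant is understood as [0]
   when its argument is not positive definite. The entries of [x] are in turn
   integrated one at a time: as a function of the first entry [t] of [x], the
   determinant is [det Q' det P / det Q - (det Q / b) (t - t0)^2], where [Q] is
   [P] without its first row and column and [Q' = Q - x' x'^T / b], so the
   integral over [t] leaves a multiple of [(det Q')^(d + 1/2)] and the
   exponent increases by 1/2. The one-dimensional constant
   [int (1 - t^2)^d dt = sqrt pi Gamma(d + 1) / Gamma(d + 3/2)] is obtained by
   Tonelli from the Gaussian integral. *)

(** * One-variable integrals: affine substitution, the Gamma integral, truncated powers of a
    quadratic *)

Section one_dim.
Context {R : realType}.
Local Notation mu := (@lebesgue_measure R).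
Implicit Types (a b c d x y : R).

Lemma measurable_affine c b :
  measurable_fun [set: measurableTypeR R]
    (fun x : measurableTypeR R => c * x + b : measurableTypeR R).
Proof. by apply: measurable_funD => //; exact: measurable_funM. Qed.

(** Lebesgue measure is determined by its values on the intervals []u, v]], and the preimage of such
    an interval under the affine map has its length divided by [c]. *)
Lemma lebesgue_measure_affine c b (A : set (measurableTypeR R)) : 0 < c ->
  measurable A ->
  mu A = (c%:E * pushforward mu
    (fun x : measurableTypeR R => (c * x + b)%R : measurableTypeR R) A)%E.
Proof.
move=> c0 mA.
pose p : {measure set (measurableTypeR R) -> \bar R} :=
  measure_function_pushforward__canonical__measure_function_Measure mu
    (measurable_affine c b).
pose k : {nonneg R} := NngNum (ltW c0).
apply: (@lebesgue_measure_unique R (mscale k p)) => // _ [[u v]] _ <-.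
have E : (fun x : R => c * x + b) @^-1` `]u, v] =
    `](u - b) / c, (v - b) / c]%classic.
  apply/seteqP; split => x /=; rewrite !in_itv/=.
    by rewrite ltr_pdivrMr// ler_pdivlMr// ltrBlDr lerBrDr mulrC.
  by rewrite ltr_pdivrMr// ler_pdivlMr// ltrBlDr lerBrDr mulrC.
transitivity (c%:E * mu ((fun x : R => (c * x + b)%R) @^-1` `]u, v]))%E; last by [].
rewrite E !lebesgue_measure_itv/= !lte_fin ltr_pM2r ?invr_gt0// ltrD2r.
case: ifPn => _; last by rewrite mule0.
by rewrite -!EFinD -EFinM; congr EFin; field; exact: lt0r_neq0.
Qed.

Lemma integral_affine c b (f : R -> \bar R) : 0 < c ->
  measurable_fun [set: measurableTypeR R] f -> (forall x, 0 <= f x)%E ->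
  (\int[mu]_x f x = c%:E * \int[mu]_x f (c * x + b)%R)%E.
Proof.
move=> c0 mf f0.
pose p : {measure set (measurableTypeR R) -> \bar R} :=
  measure_function_pushforward__canonical__measure_function_Measure mu
    (measurable_affine c b).
pose k : {nonneg R} := NngNum (ltW c0).
rewrite (@eq_measure_integral _ _ _ _ (mscale k p)); last first.
  by move=> A mA _; exact: (@lebesgue_measure_affine c b A c0 mA).
rewrite ge0_integral_mscale//=; congr (_ * _)%E.
by rewrite ge0_integral_pushforward//; exact: measurable_affine.
Qed.

(* Junk convention: [ppow] vanishes for [y <= 0], whereas [0 `^ 0 = 1]. *)
Definition ppow d y : R := if 0 < y then y `^ d else 0.

Lemma ppow_ge0 d y : 0 <= ppow d y.
Proof. by rewrite /ppow; case: ifP => // _; exact: powR_ge0. Qed.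

Lemma ppow_le0 d y : y <= 0 -> ppow d y = 0.
Proof. by rewrite /ppow ltNge => ->. Qed.

Lemma ppowM d c y : 0 < c -> ppow d (c * y) = c `^ d * ppow d y.
Proof.
move=> c0; rewrite /ppow pmulr_rgt0//; case: ifPn => [y0|_]; last by rewrite mulr0.
by rewrite powRM// ltW.
Qed.

Lemma measurable_ppow d : measurable_fun [set: measurableTypeR R] (ppow d).
Proof.
apply: (@measurable_fun_ifT _ _ _ _ (fun y : measurableTypeR R => powR y d)
  (fun=> 0) (fun y : measurableTypeR R => 0 < y)) => //.
have m0 : measurable_fun [set: measurableTypeR R] (cst (0 : R)) by exact: measurable_cst.
have m1 : measurable_fun [set: measurableTypeR R] (fun y : measurableTypeR R => y : R).
  exact: measurable_id.
exact: (measurable_fun_ltr m0 m1).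
Qed.

(** The Gamma integrand extended by zero to the whole line, where affine substitution and Tonelli
    apply without tracking domains. *)
Definition gamma_kernel a t : R := ppow (a - 1) t * expR (- t).

Lemma gamma_kernel_ge0 a t : 0 <= gamma_kernel a t.
Proof. by rewrite mulr_ge0 ?ppow_ge0 ?expR_ge0. Qed.

Lemma measurable_gamma_kernel a :
  measurable_fun [set: measurableTypeR R] (gamma_kernel a).
Proof.
apply: measurable_funM; first exact: measurable_ppow.
by apply: measurableT_comp => //; exact: measurable_funN.
Qed.

(** Monotone convergence along the intervals from 1/(n + 1) to 1: the primitive t^a / a bounds each
    of these integrals by [a^-1]. *)
Lemma integral_powR01_lty a : 0 < a ->
  (\int[mu]_(t in `]0%R, 1%R]) (t `^ (a - 1))%:E < +oo)%E.
Proof.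
move=> a0.
pose F (n : nat) : set (measurableTypeR R) := `[(n.+1%:R)^-1, 1]%classic.
have UF : `]0%R, 1%R]%classic = \bigcup_n F n.
  apply/seteqP; split => [x|x [n _]]; rewrite /F/= !in_itv/=.
    move=> /andP[x0 x1].
    have [n nx] := @ltr_add_invr R 0 x x0.
    by exists n => //; rewrite /F/= in_itv/= x1 andbT ltW//; rewrite add0r in nx.
  by move=> /andP[nx ->]; rewrite andbT; apply: lt_le_trans nx; rewrite invr_gt0.
have nF : nondecreasing_seq F.
  move=> i j ij; rewrite subsetEset; apply: subset_itvr; rewrite bnd_simp.
  by rewrite lef_pV2 ?posrE// ler_nat ltnS.
have mp : measurable_fun [set: measurableTypeR R] (fun t => (t `^ (a - 1))%:E).
  by apply/measurable_EFinP; exact: measurable_powR.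
have := @ge0_nondecreasing_set_cvg_integral _ (measurableTypeR R) _ F
  (fun t => (t `^ (a - 1))%:E) mu nF (fun i => measurable_itv _)
  (fun i => measurable_funTS mp) (fun i x _ => (powR_ge0 _ _ : 0 <= (_)%:E)%E).
rewrite -UF => cv.

apply: (@le_lt_trans _ _ (a^-1)%:E); last exact: ltry.
rewrite -(cvg_lim (@ereal_hausdorff R) cv).
apply: lime_le; first by apply/cvg_ex; eexists; exact: cv.
apply: nearW => n; rewrite /F.
have n0 : 0 < n.+1%:R^-1 :> R by rewrite invr_gt0.
(* For [n = 0] the interval is a single point, and the fundamental theorem needs distinct
   endpoints. *)
have [->|/eqP n1] := eqVneq n 0%N.
  rewrite invr1 set_itv1 integral_set1 lee_fin invr_ge0; exact: ltW.
have lt1 : n.+1%:R^-1 < 1 :> R by rewrite invf_lt1 ?ltr0n// ltr1n ltnS lt0n; apply/eqP.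
have dp : {in `]0, +oo[, forall x : R, derivable (fun t => a^-1 * t `^ a) x 1}.
  by move=> x x0; apply: derivableM => //; exact: derivable_powR.
have cp (r x : R) : x \in `]0, +oo[ -> {for x, continuous (fun t : R => t `^ r)}.
  move=> x0; apply/differentiable_continuous; rewrite -derivable1_diffP.
  exact: derivable_powR.
have ct (x : R) : x \in `]0, +oo[ -> {for x, continuous (fun t => a^-1 * t `^ a)}.
  by move=> x0; apply/differentiable_continuous; rewrite -derivable1_diffP; exact: dp.
rewrite (@continuous_FTC2 _ _ (fun t => a^-1 * t `^ a))//.
- rewrite -EFinB lee_fin powR1 mulr1 lerBlDr lerDl mulr_ge0 ?powR_ge0// invr_ge0.
  exact: ltW.
- apply: continuous_in_subspaceT => x; rewrite inE/= in_itv/= => /andP[x0 _].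
  by apply: cp; rewrite in_itv/= andbT; exact: lt_le_trans x0.
- split.
  + move=> x; rewrite in_itv/= => /andP[x0 _].
    by apply: dp; rewrite in_itv/= andbT; exact: lt_trans x0.
  + by apply: cvg_at_right_filter; apply: ct; rewrite in_itv/= andbT.
  + by apply: cvg_at_left_filter; apply: ct; rewrite in_itv/= andbT.
- move=> x; rewrite in_itv/= => /andP[x0 _].
  have xp : x \in `]0, +oo[ by rewrite in_itv/= andbT; exact: lt_trans x0.
  rewrite derive1Ml ?powR_derive1//; last exact: derivable_powR.
  by rewrite mulrA mulVf ?mul1r// gt_eqF.
Qed.

(** Half of the exponential decay absorbs the power. In logarithms, with [c] the absolute value of
    [a - 1] and [k = 2 * c + 1], concavity gives [ln t <= t / k + ln k], and [c / k] is at most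
    1/2. *)
Lemma powR_expRN_le a t : 1 <= t ->
  t `^ (a - 1) * expR (- t) <=
  expR (`|a - 1| * ln (2 * `|a - 1| + 1)) * expR (- 2^-1 * t).
Proof.
move=> t1; have t0 : 0 < t by exact: lt_le_trans t1.
rewrite /powR gt_eqF// -!expRD ler_expR.
have ac : a - 1 <= `|a - 1| by exact: ler_norm.
have c0 : 0 <= `|a - 1| by exact: normr_ge0.
move: `|a - 1| c0 ac => /= c c0 ac.
have [k kE] : exists k : R, k = 2 * c + 1 by eexists.
rewrite -kE; have k0 : 0 < k by lra.
have lt0 : 0 <= ln t by exact: ln_ge0.
have h1 : (a - 1) * ln t <= c * ln t by apply: ler_wpM2r.
have h2 : ln t <= t / k + ln k.
  have -> : t = t / k * k by rewrite divfK// gt_eqF.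
  rewrite lnM ?posrE ?divr_gt0// mulfK ?gt_eqF// lerD2r.
  have tk0 : 0 < t / k by rewrite divr_gt0.
  have := @le_ln1Dx R (t / k - 1); rewrite (addrC 1) subrK; lra.
have h3 : c * ln t <= c * (t / k + ln k) by exact: ler_wpM2l.
have h4 : c * (t / k) <= 2^-1 * t.
  rewrite mulrCA mulrC ler_wpM2r// ?(ltW t0)// ler_pdivrMr//; lra.
by rewrite mulrDr in h3; lra.
Qed.

(** Domination by the bare power on []0, 1]] and by a multiple of the exponential density of rate
    1/2 beyond; the factor 2 in [2 * C] cancels that rate. *)
Lemma integral_gamma_kernel_lty a : 0 < a ->
  (\int[mu]_t (gamma_kernel a t)%:E < +oo)%E.
Proof.
move=> a0.
pose C := expR (`|a - 1| * ln (2 * `|a - 1| + 1)).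
have C0 : 0 <= C by exact: expR_ge0.
pose g t := ((fun t => (t `^ (a - 1))) \_ `]0, 1]) t.
pose h t := exponential_pdf (2^-1 : R) t.
have half0 : 0 < 2^-1 :> R by [].
have g0 t : 0 <= g t by rewrite /g patchE; case: ifP => // _; exact: powR_ge0.
have h0 t : 0 <= h t by apply: exponential_pdf_ge0; exact: ltW.
have mg : measurable_fun [set: measurableTypeR R] (EFin \o g).
  apply/measurable_EFinP/(measurable_restrictT (fun t => t `^ (a - 1))) => //.
  by apply: measurable_funTS; exact: measurable_powR.
have mh : measurable_fun [set: measurableTypeR R] (fun t => (2 * C * h t)%:E).
  apply/measurable_EFinP/measurable_funM => //; exact: measurable_exponential_pdf.
apply: (@le_lt_trans _ _ (\int[mu]_t ((g t)%:E + (2 * C * h t)%:E))%E).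
  apply: ge0_le_integral => //=.
  - by move=> t _; rewrite lee_fin gamma_kernel_ge0.
  - by apply/measurable_EFinP; exact: measurable_gamma_kernel.
  - exact: emeasurable_funD.
  - move=> t _; rewrite -EFinD lee_fin /gamma_kernel /ppow.
    have hh : 0 <= 2 * C * h t by rewrite mulr_ge0// mulr_ge0.
    case: ifPn => [t0|_]; last by rewrite mul0r addr_ge0.
    have [t1|t1] := leP t 1.
      apply: (@le_trans _ _ (g t)); last by rewrite lerDl.
      rewrite /g patchE mem_set/= ?in_itv/= ?t0 ?t1// ler_piMr ?powR_ge0//.
      by rewrite -expR0 ler_expR oppr_le0 ltW.
    apply: (@le_trans _ _ (2 * C * h t)); last by rewrite lerDr.
    rewrite /h exponential_pdfE; last exact: ltW.
    rewrite [leRHS](_ : _ = C * expR (- 2^-1 * t)); last by field.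
    exact/powR_expRN_le/ltW.
rewrite ge0_integralD//=; last 2 first.
- by move=> t _; rewrite lee_fin.
- by move=> t _; rewrite lee_fin mulr_ge0// mulr_ge0.
apply: lte_add_pinfty.
  have := integral_powR01_lty a0.
  rewrite integral_mkcond; congr (_ < _)%E; apply: eq_integral => t _.
  by rewrite /g !patchE; case: ifP.
under eq_integral do rewrite EFinM.
rewrite ge0_integralZl//=.
- by rewrite integral_exponential_pdf// mule1 ltry.
- by apply/measurable_EFinP; exact: measurable_exponential_pdf.
- by move=> t _; rewrite lee_fin.
- by rewrite lee_fin mulr_ge0.
Qed.

(** [Gamma] is the real part of an extended-real integral, so finiteness has to be known before the
    two can be identified. *)
Lemma integral_gamma_kernel a : 0 < a ->
  (\int[mu]_t (gamma_kernel a t)%:E = (Gamma a)%:E)%E.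
Proof.
move=> a0; rewrite /Gamma /Rintegral.
have <- : (\int[mu]_t (gamma_kernel a t)%:E =
  \int[mu]_(t in `]0%R, +oo[) (t `^ (a - 1) * expR (- t))%:E)%E.
  rewrite [RHS]integral_mkcond; apply: eq_integral => t _.
  rewrite patchE mem_setE in_itv/= andbT /gamma_kernel /ppow.
  by case: ifP; rewrite ?mul0r.
rewrite fineK//.

rewrite ge0_fin_numE ?integral_gamma_kernel_lty//.
by apply: integral_ge0 => t _; rewrite lee_fin gamma_kernel_ge0.
Qed.

(** The kernel is at least the positive constant [m] on [[1, 2]]; the minimum in [m] covers both the
    increasing and the decreasing powers. *)
Lemma Gamma_gt0 a : 0 < a -> 0 < Gamma a.
Proof.
move=> a0; rewrite -lte_fin -integral_gamma_kernel//.
pose m : R := Num.min 1 (2 `^ (a - 1)) * expR (- 2).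
have m0 : 0 < m by rewrite mulr_gt0 ?expR_gt0// lt_min ltr01 powR_gt0.
have mk : measurable_fun [set: measurableTypeR R] (EFin \o gamma_kernel a).
  by apply/measurable_EFinP; exact: measurable_gamma_kernel.
apply: (@lt_le_trans _ _ (\int[mu]_(t in `[1%R, 2%R]) (cst m%:E) t)%E).
  rewrite integral_cst//= lebesgue_measure_itv/= lte_fin ltr1n/= -EFinB -EFinM lte_fin.
  by rewrite mulr_gt0// subr_gt0 ltr1n.
apply: (@le_trans _ _ (\int[mu]_(t in `[1%R, 2%R]) (gamma_kernel a t)%:E)%E); last first.
  by apply: ge0_subset_integral => //= t _; rewrite lee_fin gamma_kernel_ge0.
apply: ge0_le_integral => //=.
- by move=> t _; rewrite lee_fin ltW.
- exact: measurable_funTS.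
move=> t; rewrite in_itv/= => /andP[t1 t2]; rewrite lee_fin /gamma_kernel /ppow.
have t0 : 0 < t by exact: lt_le_trans t1.
rewrite t0 ler_pM ?expR_ge0//.
- rewrite ge_min; have [a1|a1] := leP 0 (a - 1).
    apply/orP; left; apply: (@le_trans _ _ (1 `^ (a - 1))); first by rewrite powR1.
    by rewrite ge0_ler_powR// ?nnegrE// ltW.
  apply/orP; right; rewrite -(opprK (a - 1)) powRN (powRN t) lef_pV2 ?posrE ?powR_gt0//.
  by rewrite ge0_ler_powR// ?nnegrE ?oppr_ge0 ltW.
- by rewrite ler_expR lerN2.
Qed.

(** The Beta value B(1/2, d + 1), which is the integral of (1 - x^2)^d over [-1, 1]. *)
Definition ball_const d : R :=
  Num.sqrt pi * Gamma (d + 1) / Gamma (d + 1 + 2^-1).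

Lemma measurable_ppow_comp d disp (T : measurableType disp) (f : T -> measurableTypeR R) :
  measurable_fun setT f -> measurable_fun setT (fun t => ppow d (f t)).
Proof. by move=> mf; exact: (measurableT_comp (measurable_ppow d)). Qed.

(** Substitute x0 + sqrt(D / c) x for x; when [D <= 0] both sides vanish. The unit integral stays
    unevaluated, since its evaluation below relies on this scaling law. *)
Lemma integral_ppow_quadraticE d c D x0 : 0 < c ->
  (\int[mu]_x (ppow d (D - c * (x - x0) ^+ 2))%:E =
   (ppow (d + 2^-1) D * c `^ (- 2^-1))%:E * \int[mu]_x (ppow d (1 - x ^+ 2))%:E)%E.
Proof.
move=> c0; have [D0|D0] := leP D 0.
  rewrite (ppow_le0 _ D0) mul0r mul0e integral0_eq// => x _.
  by rewrite ppow_le0// subr_le0 (le_trans D0)// mulr_ge0 ?sqr_ge0// ltW.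
have mf : measurable_fun [set: measurableTypeR R]
    (fun x : measurableTypeR R => (ppow d (D - c * (x - x0) ^+ 2))%:E).
  apply/measurable_EFinP/measurable_ppow_comp/measurable_funB => //.
  by apply: measurable_funM => //; apply: measurable_funX; exact: measurable_funB => //.
have r0 : 0 < Num.sqrt (D / c) by rewrite sqrtr_gt0 divr_gt0.
rewrite (integral_affine x0 r0 mf); last by move=> x; rewrite lee_fin ppow_ge0.
have E x : ppow d (D - c * (Num.sqrt (D / c) * x + x0 - x0) ^+ 2) =
    D `^ d * ppow d (1 - x ^+ 2).
  rewrite addrK exprMn sqr_sqrtr; last by rewrite divr_ge0// ltW.
  rewrite -ppowM//; congr ppow; rewrite mulrBr mulr1; congr (_ - _).
  by rewrite mulrA (mulrC c) divfK// gt_eqF.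
under eq_integral do rewrite E EFinM.
rewrite ge0_integralZl//=; last 3 first.
- apply/measurable_EFinP/measurable_ppow_comp/measurable_funB => //.
- by move=> x _; rewrite lee_fin ppow_ge0.
- by rewrite lee_fin powR_ge0.
rewrite muleA; congr (_ * _)%E; rewrite -EFinM; congr EFin.
rewrite -powR12_sqrt ?divr_ge0 ?ltW// powRM ?invr_ge0 ?ltW//.
rewrite -(powR_inv1 (ltW c0)) -powRrM mulN1r /ppow D0 powRD.
  by rewrite mulrC mulrA.
by rewrite (gt_eqF D0) implybT.
Qed.

(** Tonelli for [f]: integrating first in [s] gives the Gaussian times Gamma(d + 1); integrating
    first in [x] gives, by scaling, the unknown [B] times s^(d + 1/2) exp(-s), whose integral is [B]
    times Gamma(d + 3/2). *)
Lemma integral_ppow_ball d : -1 < d ->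
  (\int[mu]_x (ppow d (1 - x ^+ 2))%:E = (ball_const d)%:E)%E.
Proof.
move=> d1; have [B BE] : exists B : \bar R, (\int[mu]_x (ppow d (1 - x ^+ 2))%:E = B)%E.
  by eexists.
rewrite BE.
have a0 : 0 < d + 1 by lra.
have b0 : 0 < d + 1 + 2^-1 by lra.
have B0 : (0 <= B)%E by rewrite -BE; apply: integral_ge0 => x _; rewrite lee_fin ppow_ge0.
have quad s : (\int[mu]_x (ppow d (s - x ^+ 2))%:E = (ppow (d + 2^-1) s)%:E * B)%E.
  have := @integral_ppow_quadraticE d 1 s 0 ltr01.
  rewrite BE powR1 mulr1 => <-; apply: eq_integral => x _.
  by rewrite mul1r subr0.
pose f (z : measurableTypeR R * measurableTypeR R) : \bar R :=
  (ppow d (z.2 - z.1 ^+ 2) * expR (- z.2))%:E.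
have mf : measurable_fun setT f.
  apply/measurable_EFinP/measurable_funM.
    have mg : measurable_fun [set: measurableTypeR R * measurableTypeR R]
        (fun z : measurableTypeR R * measurableTypeR R => z.2 - z.1 ^+ 2 : measurableTypeR R).
      by apply: measurable_funB; [exact: measurable_snd|apply: measurable_funX].
    exact: (measurable_ppow_comp d mg).
  by apply: measurableT_comp => //; exact: measurable_funN.
have f0 z : (0 <= f z)%E by rewrite lee_fin mulr_ge0 ?ppow_ge0 ?expR_ge0.
have lhs : (\int[mu]_x \int[mu]_s f (x, s) = (Num.sqrt pi * Gamma (d + 1))%:E)%E.
  rewrite EFinM -integralT_gauss -integral_gamma_kernel// -ge0_integralZr//=; last 3 first.
  - by apply/measurable_EFinP; exact: measurable_gauss_fun.
  - by move=> x _; rewrite lee_fin gauss_fun_ge0.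
  - by apply: integral_ge0 => t _; rewrite lee_fin gamma_kernel_ge0.
  apply: eq_integral => x _.
  rewrite -ge0_integralZl//=; last 3 first.
  - by apply/measurable_EFinP; exact: measurable_gamma_kernel.
  - by move=> t _; rewrite lee_fin gamma_kernel_ge0.
  - by rewrite lee_fin gauss_fun_ge0.
  rewrite [RHS](@integral_affine 1 (- x ^+ 2))//; last 2 first.
  - apply: emeasurable_funM => //.
    by apply/measurable_EFinP; exact: measurable_gamma_kernel.
  - by move=> t; rewrite -EFinM lee_fin mulr_ge0 ?gauss_fun_ge0 ?gamma_kernel_ge0.
  rewrite mul1e; apply: eq_integral => s _.
  rewrite -EFinM /f/= /gamma_kernel /gauss_fun mul1r addrK mulrCA -expRD.
  by congr (_ * expR _)%:E; ring.
have swap : (\int[mu]_x \int[mu]_s f (x, s) = \int[mu]_s \int[mu]_x f (x, s))%E.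
  exact: (@fubini_tonelli _ _ _ _ R mu mu f mf f0).
have rhs : (\int[mu]_s \int[mu]_x f (x, s) = (Gamma (d + 1 + 2^-1))%:E * B)%E.
  rewrite -(integral_gamma_kernel b0).
  transitivity (\int[mu]_s ((gamma_kernel (d + 1 + 2^-1) s)%:E * B))%E; last first.
    have mg : measurable_fun [set: measurableTypeR R] (EFin \o gamma_kernel (d + 1 + 2^-1)).
      by apply/measurable_EFinP; exact: measurable_gamma_kernel.
    have g0 (s : measurableTypeR R) : [set: measurableTypeR R] s ->
        (0 <= (EFin \o gamma_kernel (d + 1 + 2^-1)) s)%E.
      by move=> _; rewrite lee_fin gamma_kernel_ge0.
    exact: (@ge0_integralZr _ _ R mu _ measurableT _ mg _ g0 B0).
  apply: eq_integral => s _.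
  have mh : measurable_fun [set: measurableTypeR R] (fun x => (ppow d (s - x ^+ 2))%:E).
    by apply/measurable_EFinP/measurable_ppow_comp/measurable_funB.
  have h0 (x : measurableTypeR R) : [set: measurableTypeR R] x -> (0 <= (ppow d (s - x ^+ 2))%:E)%E.
    by move=> _; rewrite lee_fin ppow_ge0.
  transitivity ((expR (- s))%:E * \int[mu]_x (ppow d (s - x ^+ 2))%:E)%E.
    have e0 : (0 <= (expR (- s))%:E)%E by rewrite lee_fin expR_ge0.
    rewrite -(@ge0_integralZl _ _ R mu _ measurableT _ mh _ h0 e0).
    by apply: eq_integral => x _; rewrite /f/= mulrC EFinM.
  rewrite quad muleA -EFinM mulrC; congr (mule (_ * _)%:E B); congr ppow.
  by ring.
have G0 := Gamma_gt0 b0.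
have := etrans (esym lhs) (etrans swap rhs); clear lhs rhs swap.
case: B B0 {BE quad} => [b| |]// _.
  by rewrite -EFinM => -[E]; rewrite /ball_const E mulrAC mulfV ?mul1r// gt_eqF.
(* An infinite [B] times a positive Gamma value would be infinite, whereas the other order of
   integration gave a finite value. *)
by rewrite gt0_muley ?lte_fin.
Qed.

Lemma integral_ppow_quadratic d c D x0 : -1 < d -> 0 < c ->
  (\int[mu]_x (ppow d (D - c * (x - x0) ^+ 2))%:E =
   (ppow (d + 2^-1) D * c `^ (- 2^-1) * ball_const d)%:E)%E.
Proof.
by move=> d1 c0; rewrite integral_ppow_quadraticE// integral_ppow_ball.
Qed.

End one_dim.

(** * Iterated integrals over named coordinates *)

Section iterated_integral.
Context {R : realType} {I : eqType}.
Local Notation RT := (measurableTypeR R).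
Local Notation mu := (@lebesgue_measure R).
Local Notation env := (I -> RT).
Implicit Types (s : seq I) (e : env) (F : env -> \bar R).

Definition upd e i (x : RT) : env := fun j => if j == i then x else e j.

(** Coordinates are named by [I] rather than by position, so that changing the order of integration
    is permuting [s]; coordinates outside [s] act as parameters. *)
Fixpoint iterint s F e : \bar R :=
  if s is i :: s' then (\int[mu]_x iterint s' F (upd e i x))%E else F e.

Definition coord_measurable d (T : measurableType d) (f : T -> env) :=
  forall i, measurable_fun [set: T] (fun t => f t i).

(* Measurability tested on all measurable families of environments, so that
   no sigma-algebra on [I -> R] is needed. *)
Definition env_measurable F := forall d (T : measurableType d) (f : T -> env),
  coord_measurable f -> measurable_fun [set: T] (fun t => F (f t)).

Lemma coord_measurable_upd d (T : measurableType d) (f : T -> env) i (g : T -> RT) :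
  coord_measurable f -> measurable_fun [set: T] g ->
  coord_measurable (fun t => upd (f t) i (g t)).
Proof.
by move=> mf mg j; rewrite /upd; case: eqP => // _; exact: mf.
Qed.

Lemma coord_measurable_comp d (T : measurableType d) d' (T' : measurableType d')
    (f : T -> env) (h : T' -> T) :
  coord_measurable f -> measurable_fun [set: T'] h -> coord_measurable (f \o h).
Proof. by move=> mf mh i; exact: (measurableT_comp (mf i)). Qed.

Lemma coord_measurable_cst d (T : measurableType d) e :
  coord_measurable (fun _ : T => e).
Proof. by move=> i; exact: measurable_cst. Qed.

Lemma iterint_ge0 s F e : (forall e, 0 <= F e)%E -> (0 <= iterint s F e)%E.
Proof.
by move=> F0; elim: s e => [|i s IH] e //=; apply: integral_ge0 => x _.
Qed.

Lemma iterint0 s e : iterint s (fun=> 0%:E) e = 0%:E.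
Proof. by elim: s e => //= i s IH e; rewrite integral0_eq. Qed.

(** A family over [T] extends to one over [T * RT] whose coordinate [i] is the second projection;
    Tonelli makes the partial integral measurable in [T]. The induction hypothesis is used on the
    larger parameter space. *)
Lemma env_measurable_iterint s F : (forall e, 0 <= F e)%E ->
  env_measurable F -> env_measurable (iterint s F).
Proof.
move=> F0 mF; elim: s => [|i s IH] //= d T f mf.
apply: (@measurable_fun_fubini_tonelli_F _ _ T RT R mu
  (fun z => iterint s F (upd (f z.1) i z.2))).
- apply: IH; apply: coord_measurable_upd; last exact: measurable_snd.
  by apply: (coord_measurable_comp mf); exact: measurable_fst.
- by move=> z; exact: iterint_ge0.
Qed.

Lemma env_measurable_section F e i : env_measurable F ->
  measurable_fun [set: RT] (fun x => F (upd e i x)).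
Proof.
move=> mF; apply: mF; apply: coord_measurable_upd; first exact: coord_measurable_cst.
exact: measurable_id.
Qed.

(** Allows rewriting under all the integrals at once while treating the coordinates outside [s] as
    constants. *)
Lemma iterint_ext s F G e :
  (forall e', (forall i, i \notin s -> e' i = e i) -> F e' = G e') ->
  iterint s F e = iterint s G e.
Proof.
elim: s e => [|i s IH] e FG /=; first exact: FG.
apply: eq_integral => x _; apply: IH => e' ee'; apply: FG => j.
rewrite inE negb_or => /andP[ji js].
by rewrite ee'// /upd (negbTE ji).
Qed.

Lemma iterint_cat s t F e : iterint (s ++ t) F e = iterint s (iterint t F) e.
Proof. by elim: s e => //= i s IH e; apply: eq_integral => x _. Qed.

Lemma iterint_swap i j s F e : (forall e, 0 <= F e)%E -> env_measurable F ->
  i != j -> iterint (i :: j :: s) F e = iterint (j :: i :: s) F e.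
Proof.
move=> F0 mF ij /=.
have mG := env_measurable_iterint s F0 mF.
rewrite (@fubini_tonelli _ _ RT RT R mu mu
  (fun z => iterint s F (upd (upd e i z.1) j z.2))).
- apply: eq_integral => y _; apply: eq_integral => x _; congr iterint.
  apply/funext => k; rewrite /upd; case: eqP => [->|//].
  by rewrite eq_sym (negbTE ij).
- apply: mG; apply: coord_measurable_upd; last exact: measurable_snd.
  apply: coord_measurable_upd; last exact: measurable_fst.
  exact: coord_measurable_cst.
- by move=> z; exact: iterint_ge0.
Qed.

(** Carries the outermost variable to the innermost place by successive Tonelli swaps, so that it
    can be integrated out first. *)
Lemma iterint_rot1 i s F e : (forall e, 0 <= F e)%E -> env_measurable F ->
  i \notin s -> iterint (i :: s) F e = iterint (rcons s i) F e.
Proof.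
move=> F0 mF; elim: s e => [|j s IH] e //=.
rewrite inE negb_or => /andP[ij si].
rewrite -/(iterint (i :: j :: s) F e) iterint_swap//=.
by apply: eq_integral => x _; rewrite -IH.
Qed.

Lemma iterint_move i s t F e : (forall e, 0 <= F e)%E -> env_measurable F ->
  i \notin s -> iterint (i :: s ++ t) F e = iterint (s ++ i :: t) F e.
Proof.
move=> F0 mF si; rewrite -cat_rcons iterint_cat -iterint_rot1 /=.
- by apply: eq_integral => x _; rewrite iterint_cat.
- by move=> e'; exact: iterint_ge0.
- exact: env_measurable_iterint.
- by [].
Qed.

(** Induction on [s]: its head is located in [t] and brought to the front by [iterint_move]. *)
Lemma iterint_perm s t F e : (forall e, 0 <= F e)%E -> env_measurable F ->
  uniq s -> perm_eq s t -> iterint s F e = iterint t F e.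
Proof.
move=> F0 mF; elim: s t e => [|i s IH] t e.
  by move=> _ /perm_size/esym/eqP; rewrite size_eq0 => /eqP ->.
move=> /= /andP[si us] st.
have : i \in t by rewrite -(perm_mem st) mem_head.
move=> it; case/splitPr: it st => t1 t2 st.
have pst : perm_eq s (t1 ++ t2).
  rewrite -(perm_cons i); apply: (perm_trans st).
  by rewrite -[i :: t2]cat1s perm_catCA.
rewrite -iterint_move//=; last first.
  by move: si; rewrite (perm_mem pst) mem_cat negb_or => /andP[].
by apply: eq_integral => x _; exact: IH.
Qed.

Lemma iterintZl s F e (c : R) : 0 <= c -> (forall e, 0 <= F e)%E ->
  env_measurable F ->
  iterint s (fun e => c%:E * F e)%E e = (c%:E * iterint s F e)%E.
Proof.
move=> c0 F0 mF; elim: s e => [|i s IH] e //=.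
rewrite -ge0_integralZl//.
- by apply: eq_integral => x _.
- by apply: env_measurable_section; exact: env_measurable_iterint.
- by move=> x _; exact: iterint_ge0.
Qed.

Lemma iterint_prod s (f : I -> R -> R) (c : I -> R) e : uniq s ->
  (forall i x, 0 <= f i x) -> (forall i, measurable_fun [set: RT] (f i)) ->
  (forall i, i \in s -> \int[mu]_x (f i x)%:E = (c i)%:E)%E ->
  iterint s (fun e => (\prod_(i <- s) f i (e i))%:E) e =
  (\prod_(i <- s) c i)%:E.
Proof.
move=> us f0 mf fc; elim: s e us fc => [|i s IH] e /=; first by rewrite !big_nil.
move=> /andP[si us] fc.
have mF : env_measurable (fun e => (\prod_(i <- s) f i (e i))%:E).
  move=> d T g mg; apply/measurable_EFinP; apply: measurable_prod => j.
  by move=> _; exact: (measurableT_comp (mf j)).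
rewrite big_cons EFinM -fc ?mem_head// -ge0_integralZr//=; last 3 first.
- by apply/measurable_EFinP; exact: mf.
- by move=> x _; rewrite lee_fin.
- rewrite lee_fin big_seq prodr_ge0// => j js; rewrite -lee_fin -fc ?inE ?js ?orbT//.
  by apply: integral_ge0 => x _; rewrite lee_fin.
apply: eq_integral => x _.
rewrite -(IH (upd e i x))//; last by move=> j js; apply: fc; rewrite inE js orbT.
rewrite -iterintZl//; last by move=> e'; rewrite lee_fin prodr_ge0.
by apply: iterint_ext => e' /(_ _ si); rewrite big_cons EFinM /upd eqxx => ->.
Qed.

End iterated_integral.

(** * Positive definite matrices, Schur complements, and the integral over one matrix entry *)

Section positive_definite.
Context {R : realType}.

Lemma posdefmx_congr n (L M : 'M[R]_n) : L \in unitmx ->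
  posdefmx M -> posdefmx (L *m M *m L^T).
Proof.
move=> uL [sM pM]; split.
  by rewrite !trmx_mul trmxK sM mulmxA.
move=> v v0; have Lv0 : L^T *m v != 0.
  apply: contra_neq v0 => Lv0.
  have uLT : L^T \in unitmx by rewrite unitmx_tr.
  by rewrite -(mulKmx uLT v) Lv0 mulmx0.
by have := pM _ Lv0; rewrite trmx_mul trmxK !mulmxA.
Qed.

Lemma posdefmx_congrP n (L M : 'M[R]_n) : L \in unitmx ->
  posdefmx (L *m M *m L^T) <-> posdefmx M.
Proof.
move=> uL; split; last exact: posdefmx_congr.
have uV : invmx L \in unitmx by rewrite unitmx_inv.
move=> /(posdefmx_congr uV); rewrite trmx_inv !mulmxA mulVmx// mul1mx -mulmxA.
by rewrite mulmxV ?unitmx_tr// mulmx1.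
Qed.

Lemma posdefmx_block_diag m n (S : 'M[R]_m) (D : 'M[R]_n) :
  posdefmx (block_mx S 0 0 D) <-> posdefmx S /\ posdefmx D.
Proof.
have quad (u : 'cV[R]_m) (w : 'cV[R]_n) : ((col_mx u w)^T *m block_mx S 0 0 D *m col_mx u w) 0 0 =
    (u^T *m S *m u) 0 0 + (w^T *m D *m w) 0 0.
  rewrite tr_col_mx mul_row_block !mulmx0 addr0 add0r mul_row_col.
  by rewrite mxE.
split.
  move=> [] /eqP; rewrite tr_block_mx !trmx0 => /eqP/eq_block_mx[sS _ _ sD] p.
  split; split=> // v v0.
  - have := p (col_mx v 0); rewrite quad trmx0 !mul0mx [X in _ + X]mxE addr0; apply.
    by apply: contra_neq v0; rewrite -col_mx0 => /eq_col_mx[].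
  - have := p (col_mx 0 v); rewrite quad trmx0 !mul0mx [X in X + _]mxE add0r; apply.
    by apply: contra_neq v0; rewrite -col_mx0 => /eq_col_mx[].
move=> [[sS pS] [sD pD]]; split; first by rewrite tr_block_mx !trmx0 sS sD.
move=> v; rewrite -[v]vsubmxK quad; set u := usubmx v; set w := dsubmx v.
have [->|u0 _] := eqVneq u 0.
  have [->|w0 _] := eqVneq w 0; first by rewrite col_mx0 eqxx.
  by rewrite trmx0 !mul0mx [X in X + _]mxE add0r pD.
have [->|w0] := eqVneq w 0; first by rewrite trmx0 !mul0mx [X in _ + X]mxE addr0 pS.
by rewrite addr_gt0 ?pS ?pD.
Qed.

Lemma posdefmx_unit n (M : 'M[R]_n) : posdefmx M -> M \in unitmx.
Proof.
move=> [_ pM]; rewrite -row_free_unit -kermx_eq0.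
apply: contraT => /rowV0Pn[v /sub_kermxP vM v0].
have := pM v^T; rewrite trmxK vM mul0mx mxE ltxx; apply.
by apply: contra_neq v0 => vT0; rewrite -(trmxK v) vT0 trmx0.
Qed.

Lemma posdefmx1P (M : 'M[R]_1) : posdefmx M <-> 0 < M 0 0.
Proof.
split=> [[_ pM]|M0].
  have := pM 1; rewrite trmx1 mul1mx mulmx1; apply.
  exact: oner_neq0.
split; first by rewrite (mx11_scalar M) tr_scalar_mx.
move=> v v0; rewrite (mx11_scalar v) (mx11_scalar M) tr_scalar_mx.
rewrite -!scalar_mxM mxE eqxx mulr1n mulrAC.
have v00 : v 0 0 != 0.
  by apply: contra_neq v0 => v00; rewrite (mx11_scalar v) v00 raddf0.
by rewrite mulr_gt0// -expr2 exprn_even_gt0.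
Qed.

Section schur.
Context (m n : nat) (A : 'M[R]_m) (B : 'M[R]_(m, n)) (C : 'M[R]_(n, m)) (D : 'M[R]_n).
Hypothesis uD : D \in unitmx.

(** Block elimination with [D] as pivot; both the determinant formula and the positivity criterion
    are read off this factorization. *)
Lemma block_schur : block_mx A B C D =
  block_mx 1%:M (B *m invmx D) 0 1%:M *m
  block_mx (A - B *m invmx D *m C) 0 0 D *m
  block_mx 1%:M 0 (invmx D *m C) 1%:M.
Proof.
rewrite !mulmx_block !mul1mx !mul0mx !mulmx0 !mulmx1 !add0r ?addr0 ?mulmxKV//.
by rewrite !mulmxA mulmxV// mul1mx subrK.
Qed.

Lemma det_schur_dr : \det (block_mx A B C D) = \det D * \det (A - B *m invmx D *m C).
Proof.
rewrite block_schur !det_mulmx !det_ublock !det_lblock !det1 ?mulr1 ?mul1r.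
by rewrite mulrC.
Qed.
End schur.

(** Elimination with the other pivot; comparing it with [det_schur_dr] yields the rank-one update
    formula below. *)
Lemma det_schur_ul m n (A : 'M[R]_m) (B : 'M[R]_(m, n)) (C : 'M[R]_(n, m)) (D : 'M[R]_n) :
  A \in unitmx -> \det (block_mx A B C D) = \det A * \det (D - C *m invmx A *m B).
Proof.
move=> uA.
have -> : block_mx A B C D =
    block_mx A 0 C 1%:M *m block_mx 1%:M (invmx A *m B) 0 (D - C *m invmx A *m B).
  rewrite mulmx_block !mulmx1 !mulmx0 !mul0mx !mul1mx ?addr0 ?add0r.
  by rewrite !mulmxA mulmxV// mul1mx addrCA subrr addr0.
by rewrite det_mulmx det_lblock det_ublock !det1 mulr1 mul1r.
Qed.

(** For a symmetric block matrix the outer factors of [block_schur] are transposes of each other, so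
    the factorization is a congruence to a block diagonal matrix. *)
Lemma posdefmx_schur m n (A : 'M[R]_m) (B : 'M[R]_(m, n)) (D : 'M[R]_n) :
  posdefmx D ->
  posdefmx (block_mx A B B^T D) <-> posdefmx (A - B *m invmx D *m B^T).
Proof.
move=> pD; have uD := posdefmx_unit pD; have [sD _] := pD.
rewrite (block_schur _ _ _ uD).
have -> : block_mx 1%:M 0 (invmx D *m B^T) 1%:M =
    (block_mx 1%:M (B *m invmx D) 0 1%:M)^T :> 'M[R]_(m + n).
  by rewrite tr_block_mx !trmx1 trmx0 trmx_mul trmx_inv sD.
rewrite posdefmx_congrP; last by rewrite unitmxE det_ublock !det1 mulr1 unitr1.
by rewrite posdefmx_block_diag; split => [[]|].
Qed.

Lemma posdefmx_drsub m n (M : 'M[R]_(m + n)) : posdefmx M -> posdefmx (drsubmx M).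
Proof.
move=> [sM pM]; split; first by rewrite trmx_drsub sM.
move=> v v0; have := pM (col_mx 0 v).
have -> : (col_mx 0 v)^T *m M *m col_mx 0 v = v^T *m drsubmx M *m v.
  rewrite -{1}[M]submxK tr_col_mx mul_row_block trmx0 !mul0mx !add0r.
  by rewrite mul_row_col mulmx0 add0r.
by apply; apply: contra_neq v0; rewrite -col_mx0 => /eq_col_mx[].
Qed.

Lemma posdefmx_schur1 n (M : 'M[R]_(1 + n)) : M^T = M -> posdefmx (drsubmx M) ->
  exists S : 'M[R]_1, (posdefmx M <-> posdefmx S) /\
    \det M = \det (drsubmx M) * S 0 0.
Proof.
move=> sM.
have : M = block_mx (ulsubmx M) (ursubmx M) (ursubmx M)^T (drsubmx M).
  by rewrite trmx_ursub sM submxK.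
move: (ulsubmx M) (ursubmx M) (drsubmx M) => A B D -> pD.
exists (A - B *m invmx D *m B^T); split; first exact: posdefmx_schur.
by rewrite det_schur_dr ?det_mx11//; exact: posdefmx_unit.
Qed.

Lemma posdefmx_det_gt0 n (M : 'M[R]_n) : posdefmx M -> 0 < \det M.
Proof.
elim: n M => [|n IH] M pM; first by rewrite det_mx00.
have pD := @posdefmx_drsub 1 n M pM; have [sM _] := pM.
have [S [MS ->]] := @posdefmx_schur1 n M sM pD.
by rewrite mulr_gt0 ?IH//; apply/posdefmx1P/MS.
Qed.

(** Recursive form of Sylvester's criterion, on trailing minors: the Schur complement of the
    trailing block is a scalar with the sign of the determinant. *)
Lemma posdefmx_step n (M : 'M[R]_(1 + n)) : M^T = M ->
  posdefmx M <-> posdefmx (drsubmx M) /\ 0 < \det M.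
Proof.
move=> sM; split=> [pM|[pD]].
  by split; [exact: posdefmx_drsub|exact: posdefmx_det_gt0].
have [S [MS ->]] := posdefmx_schur1 sM pD.
by rewrite pmulr_rgt0 ?posdefmx_det_gt0// MS posdefmx1P.
Qed.

(** Adding back a positive semidefinite term can only increase the quadratic form. It shows that
    column integrals vanish when [M] is not positive definite. *)
Lemma posdefmx_subr n (M : 'M[R]_n) (c : R) (x : 'cV[R]_n) : 0 <= c ->
  posdefmx (M - c *: (x *m x^T)) -> posdefmx M.
Proof.
move=> c0 [sM pM]; split.
  move: sM; rewrite linearB/= linearZ/= trmx_mul trmxK => /addIr; exact.
move=> v v0; apply: (lt_le_trans (pM v v0)).
rewrite mulmxBr mulmxBl [leLHS]mxE gerDl [leLHS]mxE oppr_le0.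
rewrite -scalemxAr -scalemxAl mxE mulr_ge0// mulmxA -(mulmxA _ x^T v).
have -> : x^T *m v = (v^T *m x)^T by rewrite trmx_mul trmxK.
by rewrite mxE big_ord1 [X in _ * X]mxE -expr2 sqr_ge0.
Qed.

Lemma posdefmx_sub_sym n (M : 'M[R]_n) (c : R) (x : 'cV[R]_n) : M^T = M ->
  (M - c *: (x *m x^T))^T = M - c *: (x *m x^T).
Proof. by move=> sM; rewrite linearB/= linearZ/= trmx_mul trmxK sM. Qed.

(** Extension by zero off the cone. Testing the sign of the determinant would not do: minus the
    identity of size 2 has determinant 1. *)
Definition pdpow n d (M : 'M[R]_n) : R :=
  if `[< posdefmx M >] then \det M `^ d else 0.

Lemma pdpow_ge0 n d (M : 'M[R]_n) : 0 <= pdpow d M.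
Proof. by rewrite /pdpow; case: ifP => // _; exact: powR_ge0. Qed.

Lemma pdpowE n d (M : 'M[R]_n) : posdefmx M -> pdpow d M = \det M `^ d.
Proof. by move=> pM; rewrite /pdpow asboolT. Qed.

Lemma pdpow_npd n d (M : 'M[R]_n) : ~ posdefmx M -> pdpow d M = 0.
Proof. by move=> pM; rewrite /pdpow asboolF. Qed.

Lemma measurable_det disp (T : measurableType disp) n (M : T -> 'M[R]_n) :
  (forall i j, measurable_fun [set: T] (fun t => M t i j)) ->
  measurable_fun [set: T] (fun t => \det (M t)).
Proof.
move=> mM; apply: measurable_sum => s.
apply: measurable_funM; first exact: measurable_cst.
by apply: measurable_prod => i _; exact: mM.
Qed.

(** The definition quantifies over uncountably many vectors; [posdefmx_step] replaces it by finitely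
    many strict polynomial inequalities. *)
Lemma measurable_posdefmx disp (T : measurableType disp) n (M : T -> 'M[R]_n) :
  (forall t, (M t)^T = M t) ->
  (forall i j, measurable_fun [set: T] (fun t => M t i j)) ->
  measurable_fun [set: T] (fun t => `[< posdefmx (M t) >]).
Proof.
elim: n M => [|n IH] M sM mM.
  rewrite (_ : (fun _ => _) = cst true); first exact: measurable_cst.
  apply/funext => t; apply/asboolP; split => // v.
  by rewrite (flatmx0 v) eqxx.
rewrite (_ : (fun _ => _) = fun t =>
    `[< posdefmx (drsubmx (M t : 'M[R]_(1 + n))) >] && (0 < \det (M t))); last first.
  apply/funext => t; apply/asboolP/andP.
    by move=> /(@posdefmx_step n _ (sM t))[pD dM]; split => //; apply/asboolP.
  by move=> [/asboolP pD dM]; apply/(@posdefmx_step n _ (sM t)).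
apply: measurable_and.
  apply: IH => [t|i j]; first by rewrite trmx_drsub sM.
  under eq_fun do rewrite !mxE; exact: mM.
have m0 : measurable_fun [set: T] (cst (0 : R)) by exact: measurable_cst.
exact: (measurable_fun_ltr m0 (measurable_det mM)).
Qed.

Lemma measurable_pdpow disp (T : measurableType disp) n d (M : T -> 'M[R]_n) :
  (forall t, (M t)^T = M t) ->
  (forall i j, measurable_fun [set: T] (fun t => M t i j)) ->
  measurable_fun [set: T] (fun t => pdpow d (M t)).
Proof.
move=> sM mM.
have m1 := measurableT_comp (measurable_powR d) (measurable_det mM).
exact: (measurable_fun_ifT (measurable_posdefmx sM mM) m1 (measurable_cst (0 : R))).
Qed.

(** Isolates the dependence on [t]: it affects the first row and column, but not the trailing
    block. *)
Lemma block_subr_col n (p t b : R) (q : 'rV[R]_n) (Q : 'M[R]_n) (x : 'cV[R]_n) :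
  block_mx p%:M q q^T Q - b^-1 *: (col_mx t%:M x *m (col_mx t%:M x)^T) =
  block_mx (p - t ^+ 2 / b)%:M (q - (t / b) *: x^T) (q - (t / b) *: x^T)^T
           (Q - b^-1 *: (x *m x^T)).
Proof.
rewrite tr_col_mx mul_col_row tr_scalar_mx scale_block_mx opp_block_mx add_block_mx.
rewrite -scalar_mxM mul_scalar_mx mul_mx_scalar !scalerA -scale_scalar_mx.
congr block_mx.
- by rewrite raddfB/=; congr (_ - _); apply/matrixP => i j; rewrite !mxE; ring.
- by rewrite mulrC.
- by rewrite [RHS]linearB/= [X in _ = _ - X]linearZ/= trmxK mulrC.
Qed.

(** Both Schur formulas are applied to the bordered matrix with corner [- b], border [x] and
    trailing block [Q']; the pivot [- b] restores [Q] from [Q']. *)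
Lemma det_rank1_update n (Q : 'M[R]_n) (x : 'cV[R]_n) (b : R) : 0 < b ->
  Q - b^-1 *: (x *m x^T) \in unitmx ->
  \det Q = \det (Q - b^-1 *: (x *m x^T)) *
    ((b + (x^T *m invmx (Q - b^-1 *: (x *m x^T)) *m x) 0 0) / b).
Proof.
set Q' := Q - _ => b0 uQ'.
have bu : ((- b)%:M : 'M[R]_1) \in unitmx.
  by rewrite unitmxE det_scalar expr1 unitfE oppr_eq0 gt_eqF.
have e1 := @det_schur_ul 1 n (- b)%:M x^T x Q' bu.
have e2 := @det_schur_dr 1 n (- b)%:M x^T x Q' uQ'.
have : \det Q' * (- b - (x^T *m invmx Q' *m x) 0 0) = - b * \det Q.
  move: e1; rewrite e2 det_scalar expr1 det_mx11 !mxE eqxx mulr1n => ->.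
  congr (_ * \det _).
  rewrite invmx_scalar mul_mx_scalar -scalemxAl invrN scaleNr opprK.
  by rewrite /Q' subrK.
move=> e; apply: (@mulfI _ (- b)); first by rewrite oppr_eq0 gt_eqF.
by rewrite -e; field; rewrite gt_eqF.
Qed.

(** The Schur complement of [Q'] is quadratic in [t]. Completing the square leaves a constant term
    that the inverse of [Q] identifies as [\det P / \det Q], and [detQ] rewrites the leading
    coefficient. *)
Lemma det_block_subr_col n (p b : R) (q : 'rV[R]_n) (Q : 'M[R]_n) (x : 'cV[R]_n)
    (P := block_mx p%:M q q^T Q) (Q' := Q - b^-1 *: (x *m x^T)) :
  0 < b -> posdefmx Q -> posdefmx Q' ->
  exists t0 : R, forall t,
    \det (P - b^-1 *: (col_mx t%:M x *m (col_mx t%:M x)^T)) =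
    \det Q' * \det P / \det Q - \det Q / b * (t - t0) ^+ 2.
Proof.
move=> b0 pQ pQ'; have [sQ _] := pQ; have [sQ' _] := pQ'.
have uQ := posdefmx_unit pQ; have uQ' := posdefmx_unit pQ'.
pose w := invmx Q'.
have sw : w^T = w by rewrite /w trmx_inv sQ'.
pose al := (x^T *m w *m x) 0 0; pose ga := (q *m w *m x) 0 0.
pose ep := (q *m w *m q^T) 0 0.
have alE : x^T *m w *m x = al%:M by rewrite -mx11_scalar.
have gaE : q *m w *m x = ga%:M by rewrite -mx11_scalar.
have epE : q *m w *m q^T = ep%:M by rewrite -mx11_scalar.
have gaE' : x^T *m w *m q^T = ga%:M.
  by rewrite -tr_scalar_mx -gaE !trmx_mul sw mulmxA.
have detQ : \det Q = \det Q' * ((b + al) / b) by exact: det_rank1_update.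
have Q'E : Q - b^-1 *: (x *m x^T) = Q' by [].
have QE : Q = Q' + b^-1 *: (x *m x^T) by rewrite subrK.
clearbody Q'.
have dQ0 := posdefmx_det_gt0 pQ; have dQ'0 := posdefmx_det_gt0 pQ'.
have bal0 : b + al != 0.
  by apply: contraTneq dQ0 => h; rewrite detQ h mul0r mulr0 ltxx.
have b0' : b != 0 by rewrite gt_eqF.
(* Sherman-Morrison *)
have invQ : invmx Q = w - (b + al)^-1 *: (w *m x *m x^T *m w).
  apply: (can_inj (mulKmx uQ)); rewrite mulmxV//.
  rewrite QE.
  have Qw : Q' *m w = 1%:M by rewrite mulmxV.
  rewrite mulmxBr -scalemxAr !mulmxA !mulmxDl -!scalemxAl ?mulmxA Qw mul1mx.
  have -> : x *m x^T *m w *m x *m x^T *m w = al *: (x *m x^T *m w).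
    rewrite -!mulmxA (mulmxA x^T) (mulmxA (x^T *m w)) alE mul_scalar_mx -scalemxAr.
    by rewrite !mulmxA.
  rewrite -[1%:M in LHS]addr0 -addrA; congr (_ + _).
  by apply/matrixP => i j; rewrite !mxE; field; rewrite b0' bal0.
have detP : \det P = \det Q * (p - ep + ga ^+ 2 / (b + al)).
  rewrite /P det_schur_dr// invQ; congr (_ * _).
  rewrite mulmxBr mulmxBl epE -scalemxAr -scalemxAl !mulmxA.
  have -> : q *m w *m x *m x^T *m w *m q^T = (ga ^+ 2)%:M.
    by rewrite gaE -!mulmxA (mulmxA x^T) gaE' -scalar_mxM expr2.
  rewrite det_mx11 !mxE eqxx !mulr1n; ring.
(* The vertex of the parabola with linear term [2 * ga * t / b] and quadratic term
   [- (b + al) * t ^+ 2 / b ^+ 2]. *)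
exists (ga * b / (b + al)) => t.
rewrite block_subr_col Q'E det_schur_dr// detP detQ.
have -> : (q - (t / b) *: x^T)^T = q^T - (t / b) *: x.
  by rewrite [LHS]linearB/= [X in _ - X]linearZ/= trmxK.
rewrite -/w !mulmxBl !mulmxBr -!scalemxAl -!scalemxAr.
rewrite epE gaE gaE' alE det_mx11 !mxE eqxx !mulr1n.
by field; rewrite b0' bal0 gt_eqF.
Qed.

Lemma integral_pdpow_col n (P : 'M[R]_(1 + n)) (x : 'cV[R]_n) (b d : R) :
  posdefmx P -> 0 < b -> -1 < d ->
  (\int[@lebesgue_measure R]_t
     (pdpow d (P - b^-1 *: (col_mx t%:M x *m (col_mx t%:M x)^T)))%:E =
   (\det P `^ (d + 2^-1) * \det (drsubmx P) `^ (- (d + 1)) * b `^ 2^-1 *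
     ball_const d * pdpow (d + 2^-1) (drsubmx P - b^-1 *: (x *m x^T)))%:E)%E.
Proof.
move=> pP b0 d1; have [sP _] := pP.
have pQ := posdefmx_drsub pP.
have : P = block_mx (ulsubmx P 0 0)%:M (ursubmx P) (ursubmx P)^T (drsubmx P).
  by rewrite -mx11_scalar trmx_ursub sP submxK.
move: (ulsubmx P 0 0) (ursubmx P) (drsubmx P) pQ => p q Q pQ PE.
have dP0 := posdefmx_det_gt0 pP; have dQ0 := posdefmx_det_gt0 pQ.
set Q' := Q - _.
have drE t : drsubmx (P - b^-1 *: (col_mx t%:M x *m (col_mx t%:M x)^T)) = Q'.
  by rewrite PE block_subr_col block_mxKdr.
have symM t := posdefmx_sub_sym b^-1 (col_mx t%:M x : 'cV_(1 + n)) sP.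
(* [Q'] is the trailing block for every [t], so if it is not positive definite the integrand is
   identically zero. *)
have [pQ'|npQ'] := pselect (posdefmx Q'); last first.
  rewrite (pdpow_npd _ npQ') mulr0 integral0_eq// => t _.
  by rewrite pdpow_npd// => /posdefmx_drsub; rewrite drE.
have dQ'0 := posdefmx_det_gt0 pQ'.
have [t0 detE] := @det_block_subr_col n p b q Q x b0 pQ pQ'.
(* Once [Q'] is positive definite, [posdefmx_step] reduces positivity of the whole matrix to that of
   its determinant, which is a quadratic in [t]. *)
transitivity (\int[@lebesgue_measure R]_t
  (ppow d (\det Q' * \det P / \det Q - \det Q / b * (t - t0) ^+ 2))%:E)%E.
  apply: eq_integral => t _; rewrite {2}PE -detE -PE /pdpow /ppow; congr EFin.
  by congr (if _ then _ else _); apply/asboolP/idP => [/posdefmx_det_gt0//|dM];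
    apply/(posdefmx_step (symM t)); rewrite drE.
rewrite integral_ppow_quadratic ?divr_gt0//; congr EFin.
rewrite (pdpowE _ pQ') /ppow !mulr_gt0 ?invr_gt0//.
rewrite powRM ?mulr_ge0 ?invr_ge0 ?ltW// powRM ?ltW// powRM ?invr_ge0 ?ltW//.
have -> : b^-1 `^ (- 2^-1) = b `^ 2^-1.
  by rewrite -(powR_inv1 (ltW b0)) -powRrM; congr powR; ring.
have -> : (\det Q)^-1 `^ (d + 2^-1) = \det Q `^ (- (d + 2^-1)).
  by rewrite -(powR_inv1 (ltW dQ0)) -powRrM; congr powR; ring.
have -> : \det Q `^ (- (d + 1)) = \det Q `^ (- (d + 2^-1)) * \det Q `^ (- 2^-1).
  by rewrite -powRD ?(gt_eqF dQ0) ?implybT//; congr powR; field.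
by ring.
Qed.

End positive_definite.

(** * Integration over whole columns of the off-diagonal block *)

Section columns.
Context {R : realType} {I : eqType}.
Local Notation RT := (measurableTypeR R).
Local Notation mu := (@lebesgue_measure R).
Local Notation env := (I -> RT).
Implicit Types (d : R) (e : env).

Definition env_real_measurable (f : env -> R) :=
  forall disp (T : measurableType disp) (g : T -> env),
  coord_measurable g -> measurable_fun [set: T] (fun t => f (g t)).

Lemma env_measurable_pdpow n d (M : env -> 'M[R]_n) :
  (forall e, (M e)^T = M e) ->
  (forall i j, env_real_measurable (fun e => M e i j)) ->
  env_measurable (fun e => (pdpow d (M e))%:E).
Proof.
move=> sM mM disp T g mg; apply/measurable_EFinP; apply: measurable_pdpow => //.
by move=> i j; exact: mM.
Qed.

Definition colv m (h : 'I_m -> I) e : 'cV[R]_m := \col_i (e (h i) : R).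

Lemma colv_measurable m (h : 'I_m -> I) i j :
  env_real_measurable (fun e => (colv h e *m (colv h e)^T) i j).
Proof.
move=> disp T g mg; under eq_fun do rewrite !mxE big_ord1 !mxE.
by apply: measurable_funM; exact: mg.
Qed.

(** The integral of (1 - |x|^2)^d over the unit ball of dimension [m]. Each integrated entry raises
    the exponent by 1/2. *)
Definition col_const m d : R := \prod_(i < m) ball_const (d + i%:R / 2).

Lemma ball_const_ge0 d : -1 < d -> 0 <= ball_const d.
Proof.
move=> d1; rewrite /ball_const divr_ge0 ?mulr_ge0 ?sqrtr_ge0//; apply/ltW/Gamma_gt0; lra.
Qed.

Lemma col_const_ge0 m d : -1 < d -> 0 <= col_const m d.
Proof.
move=> d1; apply: prodr_ge0 => i _; apply: ball_const_ge0.
by apply: (lt_le_trans d1); rewrite lerDl divr_ge0.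
Qed.

Lemma posdefmx0 (M : 'M[R]_0) : posdefmx M.
Proof. by split=> [|v]; [apply/matrixP => -[]|rewrite (flatmx0 v) eqxx]. Qed.

(** Induction on [m]: the entry [h ord0] is integrated first, which leaves the same problem for [Q],
    the remaining entries [h'] and the exponent [d + 2^-1]. *)
Lemma iterint_col m (h : 'I_m -> I) (P : 'M[R]_m) (b d : R) e : injective h ->
  posdefmx P -> 0 < b -> -1 < d ->
  iterint [seq h i | i <- enum 'I_m]
    (fun e => (pdpow d (P - b^-1 *: (colv h e *m (colv h e)^T)))%:E) e =
  (\det P `^ (d + 2^-1) * b `^ (m%:R / 2) * col_const m d)%:E.
Proof.
move=> + + b0; elim: m h P d e => [|m IH] h P d e hI pP d1.
  rewrite enum_ord0 /= pdpowE; last exact: posdefmx0.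
  by rewrite !det_mx00 !powR1 mul0r powRr0 /col_const big_ord0 !mulr1.
have [sP _] := pP.
pose h' i := h (lift ord0 i).
have h'I : injective h' by move=> i j /hI/lift_inj.
have h0h' : h ord0 \notin [seq h' i | i <- enum 'I_m].
  by apply/mapP => -[i _ /hI/eqP]; rewrite (negbTE (neq_lift _ _)).
have symM k (M : 'M[R]_k) (g : 'I_k -> I) : M^T = M ->
    forall e, (M - b^-1 *: (colv g e *m (colv g e)^T))^T =
    M - b^-1 *: (colv g e *m (colv g e)^T).
  by move=> sM e'; exact: posdefmx_sub_sym.
have mF k (M : 'M[R]_k) (g : 'I_k -> I) c : M^T = M -> env_measurable
    (fun e => (pdpow c (M - b^-1 *: (colv g e *m (colv g e)^T)))%:E).
  move=> sM; apply: env_measurable_pdpow; first exact: symM.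
  move=> i j disp T f mf; under eq_fun do rewrite mxE [X in _ + X]mxE [X in - X]mxE.
  apply: measurable_funB => //; apply: measurable_funM => //.
  exact: colv_measurable.
(* The first entry is made innermost, so that [integral_pdpow_col] applies with the other entries
   fixed. *)
rewrite enum_ordSl /= -map_comp -/(iterint (h ord0 :: _) _ e) iterint_rot1//.
- rewrite -cats1 iterint_cat /=.
  pose Q : 'M[R]_m := drsubmx (P : 'M[R]_(1 + m)).
  have pQ : posdefmx Q by exact: (@posdefmx_drsub R 1 m).
  pose K := \det P `^ (d + 2^-1) * \det Q `^ (- (d + 1)) * b `^ 2^-1 * ball_const d.
  have K0 : 0 <= K by rewrite mulr_ge0 ?ball_const_ge0// !mulr_ge0// powR_ge0.
  transitivity (iterint [seq h' i | i <- enum 'I_m] (fun e => K%:E *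
      (pdpow (d + 2^-1) (Q - b^-1 *: (colv h' e *m (colv h' e)^T)))%:E)%E e).
    apply: iterint_ext => e' _.
    rewrite -EFinM; apply: (etrans _ (@integral_pdpow_col _ m P (colv h' e') b d pP b0 d1)).
    apply: eq_integral => t _; congr (pdpow d (P - b^-1 *: _))%:E.
    have -> : colv h (upd e' (h ord0) t) = col_mx t%:M (colv h' e').
      apply/(@matrixP R (1 + m) 1) => i j.
      case: (split_ordP i) => k -> {i}.
        rewrite (@col_mxEu R 1 m 1) mxE ord1 /upd lshift0 eqxx mxE.
        by rewrite (ord1 j).
      rewrite (@col_mxEd R 1 m 1) !mxE /upd rshift1 (inj_eq hI) eq_sym.
      by rewrite (negbTE (neq_lift _ _)).
    by [].
  rewrite iterintZl//; last 2 first.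
  + by move=> e'; rewrite lee_fin pdpow_ge0.
  + by apply: mF; have [] := pQ.
  rewrite IH//; last by lra.
  have dQ0 := posdefmx_det_gt0 pQ.
  rewrite -EFinM /K; congr EFin.
  have -> : col_const m.+1 d = ball_const d * col_const m (d + 2^-1).
    rewrite /col_const big_ord_recl /= mul0r addr0; congr (_ * _).
    apply: eq_bigr => i _; congr ball_const.
    by rewrite /bump /= add1n -natr1; field.
  have -> : b `^ (m.+1%:R / 2) = b `^ 2^-1 * b `^ (m%:R / 2).
    by rewrite -powRD ?(gt_eqF b0) ?implybT//; congr powR; rewrite -natr1; field.
  (* The two powers of [\det Q], from the entry just integrated and from the induction hypothesis,
     cancel; only [\det P] survives. *)
  have E : \det Q `^ (- (d + 1)) * \det Q `^ (d + 2^-1 + 2^-1) = 1.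
    rewrite -powRD; last by rewrite (gt_eqF dQ0) implybT.
    have -> : - (d + 1) + (d + 2^-1 + 2^-1) = 0 by field.
    exact: powRr0.
  transitivity ((\det Q `^ (- (d + 1)) * \det Q `^ (d + 2^-1 + 2^-1)) *
    (\det P `^ (d + 2^-1) * (b `^ 2^-1 * b `^ (m%:R / 2)) *
      (ball_const d * col_const m (d + 2^-1)))); first by ring.
  by rewrite E mul1r.
- by move=> e'; rewrite lee_fin pdpow_ge0.
- exact: mF.
Qed.

(** Induction on [js]: with column [j] fixed, the inner columns see the matrix [A] minus a rank-one
    term. That matrix may leave the cone, hence [A] is only assumed symmetric. *)
Lemma iterint_cols (J : eqType) m (h : J -> 'I_m -> I) (js : seq J) (b : J -> R)
    (A : 'M[R]_m) d e :
  (forall j j' i i', h j i = h j' i' -> j = j' /\ i = i') -> uniq js ->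
  A^T = A -> {in js, forall j, 0 < b j} -> -1 < d ->
  iterint (flatten [seq [seq h j i | i <- enum 'I_m] | j <- js])
    (fun e => (pdpow d (A - \sum_(j <- js) (b j)^-1 *: (colv (h j) e *m (colv (h j) e)^T)))%:E) e =
  (pdpow (d + (size js)%:R / 2) A * \prod_(j <- js) b j `^ (m%:R / 2) *
   \prod_(k < size js) col_const m (d + k%:R / 2))%:E.
Proof.
move=> hI + + + d1; elim: js A e => [|j js IH] A e.
  by rewrite /= !big_nil big_ord0 subr0 mul0r addr0 !mulr1.
move=> /= /andP[jjs ujs] sA b0.
rewrite iterint_cat.
pose d' := d + (size js)%:R / 2.
have d'1 : -1 < d' by rewrite (lt_le_trans d1)// lerDl divr_ge0.
pose K := \prod_(j <- js) b j `^ (m%:R / 2) * \prod_(k < size js) col_const m (d + k%:R / 2).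
have K0 : 0 <= K.
  rewrite mulr_ge0// prodr_ge0// => k _; first exact: powR_ge0.
  by apply: col_const_ge0; rewrite (lt_le_trans d1)// lerDl divr_ge0.
have bj : 0 < b j by apply: b0; rewrite mem_head.
have b0' : {in js, forall j, 0 < b j} by move=> k kjs; apply: b0; rewrite inE kjs orbT.
pose F e := (pdpow d' (A - (b j)^-1 *: (colv (h j) e *m (colv (h j) e)^T)))%:E.
transitivity (iterint [seq h j i | i <- enum 'I_m] (fun e => K%:E * F e)%E e).
  apply: iterint_ext => e' _.
  rewrite /F -EFinM mulrC /K mulrA.
  apply: (etrans _ (IH (A - (b j)^-1 *: (colv (h j) e' *m (colv (h j) e')^T)) e'
    ujs (posdefmx_sub_sym _ _ sA) b0')).
  (* The inner integrations do not touch column [j], so its term can be frozen at [e'] and absorbed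
     into the matrix. *)
  apply: iterint_ext => e'' e''E.
  have vE : colv (h j) e'' = colv (h j) e'.
    apply/matrixP => i k; rewrite !mxE e''E//.
    apply/flattenP => -[s /mapP[j' j'js ->] /mapP[i' _ /hI[jj' _]]].
    by rewrite jj' j'js in jjs.
  apply: (congr1 (fun M => (pdpow d M)%:E)).
  by rewrite big_cons vE opprD addrA.
have F0 e' : (0 <= F e')%E by rewrite lee_fin pdpow_ge0.
rewrite iterintZl//; last first.
  apply: env_measurable_pdpow => [e'|i k disp T f mf]; first exact: posdefmx_sub_sym.
  under eq_fun do rewrite mxE [X in _ + X]mxE [X in - X]mxE.
  apply: measurable_funB => //; apply: measurable_funM => //.
  exact: colv_measurable.
rewrite big_cons big_ord_recr /=.
have -> : d + (size js).+1%:R / 2 = d' + 2^-1 by rewrite /d' -natr1; field.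
(* [iterint_col] needs a positive definite matrix; otherwise both sides vanish, by
   [posdefmx_subr]. *)
have [pA|npA] := pselect (posdefmx A); last first.
  rewrite (pdpow_npd _ npA) !mul0r.
  transitivity (K%:E * iterint [seq h j i | i <- enum 'I_m] (fun=> 0%:E) e)%E.
    congr (_ * _)%E; apply: iterint_ext => e' _; rewrite /F pdpow_npd//.
    by move/posdefmx_subr => /(_ _)/npA; apply; rewrite invr_ge0 ltW.
  by rewrite iterint0 mule0.
rewrite iterint_col//; last by move=> i i' /hI[].
by rewrite -EFinM pdpowE// /K; congr EFin; rewrite -/d'; ring.
Qed.

End columns.

(** * Lebesgue measure on tuples as an iterated integral *)

Section lebesgue_tuple_iterint.
Context {R : realType} {I : eqType}.
Local Notation RT := (measurableTypeR R).
Local Notation env := (I -> RT).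

Lemma measurable_pair_cons k :
  measurable_fun [set: RT * k.-tuple RT] (@pair_cons R k).
Proof. exact: (measurable_cons measurable_fst measurable_snd). Qed.

Lemma measurable_nth_tuple k i :
  measurable_fun [set: k.-tuple RT] (fun x : k.-tuple RT => nth (0 : R) x i : RT).
Proof.
have [ik|ki] := ltnP i k; last first.
  rewrite (_ : (fun _ => _) = cst (0 : R)); first exact: measurable_cst.
  by apply/funext => x; rewrite nth_default// size_tuple.
rewrite (_ : (fun _ => _) = fun x : k.-tuple RT => tnth x (Ordinal ik)).
  exact: measurable_tnth.
by apply/funext => x; rewrite (tnth_nth (0 : R)).
Qed.

(** The lookup through [index] imitates that of [graph_mx], which makes the two comparable later. *)
Definition tuple_env k (s : seq I) (e : env) (x : k.-tuple RT) : env :=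
  fun i => if i \in s then nth (0 : R) x (index i s) else e i.

Lemma coord_measurable_tuple_env k s e : coord_measurable (@tuple_env k s e).
Proof.
move=> i; rewrite /tuple_env; case: (i \in s); first exact: measurable_nth_tuple.
exact: measurable_cst.
Qed.

(** Follows the recursion of [lebesgue_tuple]: the Dirac mass evaluates [F] at the empty tuple, and
    Tonelli on the pushed-forward product peels off the head coordinate. *)
Lemma integral_lebesgue_tuple k s (F : env -> \bar R) e : uniq s -> size s = k ->
  (forall e, 0 <= F e)%E -> env_measurable F ->
  (\int[@lebesgue_tuple R k]_x F (tuple_env s e x) = iterint s F e)%E.
Proof.
move=> + + F0 mF.
have mFe k' s' e' : measurable_fun [set: k'.-tuple RT] (fun x => F (tuple_env s' e' x)).
  exact: (mF _ _ _ (@coord_measurable_tuple_env k' s' e')).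
elim: s k e => [|i s IH] [|k] e //=.
  by move=> _ _; rewrite integral_dirac ?diracE ?in_setT ?mul1e//; exact: mFe.
move=> /andP[si us] [sk].
rewrite (@ge0_integral_pushforward _ _ _ _ R _ (measurable_pair_cons (k := k)) _
  setT _ measurableT (mFe _ _ _)); last by move=> x _; exact: F0.
rewrite preimage_setT.
rewrite (@fubini_tonelli1 _ _ _ _ R (@lebesgue_measure R) (@lebesgue_tuple R k)
   ((fun x => F (tuple_env (i :: s) e x)) \o @pair_cons R k))//.
- apply: eq_integral => x _; apply: etrans (IH k (upd e i x) us sk).
  rewrite /fubini_F; apply: eq_integral => t _ /=; apply: (congr1 F).
  apply/funext => j; rewrite /tuple_env /upd inE /= eq_sym.
  by have [<-|_] := eqVneq i j; rewrite ?(negbTE si)//=; case: ifP.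
- by apply: (measurableT_comp (mFe _ _ _)); exact: measurable_pair_cons.
- by move=> z; exact: F0.
Qed.

End lebesgue_tuple_iterint.

(** * Evaluation of the constants as quotients of multivariate Gamma functions *)

Section constants.
Context {R : realType}.
Implicit Types d x : R.

(** The product telescopes: the denominator of each [ball_const] is the numerator Gamma factor of
    the next. *)
Lemma col_constE m d : -1 < d ->
  col_const m d = Num.sqrt pi ^+ m * Gamma (d + 1) / Gamma (d + 1 + m%:R / 2).
Proof.
move=> d1; have G0 k : Gamma (d + 1 + k%:R / 2) != 0.
  by rewrite gt_eqF// Gamma_gt0// ltr_wpDr ?divr_ge0//; lra.
elim: m => [|m IH].
  have := G0 0%N; rewrite /col_const big_ord0 mul0r addr0 expr0 mul1r => G.
  by rewrite mulfV.
rewrite /col_const big_ord_recr /= -/(col_const m d) IH /ball_const exprSr.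
have -> : d + m%:R / 2 + 1 = d + 1 + m%:R / 2 by ring.
have -> : d + 1 + m%:R / 2 + 2^-1 = d + 1 + m.+1%:R / 2 by rewrite -natr1; field.
by field; rewrite !G0.
Qed.

(** Reversing the order of the factors gives the three multivariate Gammas increasing arguments,
    which start at the offset [q]. *)
Lemma prod_Gamma_rev d p q N : N = (q + p)%N ->
  \prod_(i < p) Gamma (d + (N + 1)%:R / 2 - i%:R / 2) =
  \prod_(k < p) Gamma (d + 1 + (q + k)%:R / 2).
Proof.
move=> ->; rewrite (reindex_inj rev_ord_inj) /=; apply: eq_bigr => i _.
congr Gamma; rewrite natrB; last exact: ltn_ord.
by rewrite !natrD -natr1; field.
Qed.

(** After reversal, the last [m] Gamma factors of the numerator cancel those of [multi_Gamma m]; the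
    quotient of the rest by [multi_Gamma n] is a product of values of [col_constE]. *)
Lemma col_const_prod m n d : -1 < d ->
  \prod_(k < n) col_const m (d + k%:R / 2) =
  multi_Gamma (m + n) (d + (m + n + 1)%:R / 2) /
    (multi_Gamma m (d + (m + n + 1)%:R / 2) *
     multi_Gamma n (d + (m + n + 1)%:R / 2)).
Proof.
move=> d1; rewrite /multi_Gamma.
rewrite (@prod_Gamma_rev d (m + n) 0)// (@prod_Gamma_rev d m n) ?(addnC n)//.
rewrite (@prod_Gamma_rev d n m)//.
have G0 k : Gamma (d + 1 + k%:R / 2) != 0.
  by rewrite gt_eqF// Gamma_gt0// ltr_wpDr ?divr_ge0//; lra.
have PG0 p q : \prod_(k < p) Gamma (d + 1 + (q + k)%:R / 2) != 0.
  by apply/prodf_neq0 => k _; exact: G0.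
have pi0 x : pi `^ x != 0 :> R by rewrite gt_eqF// powR_gt0// pi_gt0.
have -> : \prod_(k < m + n) Gamma (d + 1 + (0 + k)%:R / 2) =
    \prod_(k < n) Gamma (d + 1 + (0 + k)%:R / 2) * \prod_(k < m) Gamma (d + 1 + (n + k)%:R / 2).
  by rewrite (addnC m n) big_split_ord.
(* The exponents of pi differ by m n / 2, which accounts for one square root of pi per edge. *)
have -> : pi `^ ((m + n)%:R * ((m + n)%:R - 1) / 4) =
    pi `^ (m%:R * (m%:R - 1) / 4) * pi `^ (n%:R * (n%:R - 1) / 4) *
    Num.sqrt pi ^+ m ^+ n :> R.
  rewrite -powR12_sqrt ?pi_ge0// -!powR_mulrn ?powR_ge0// -!powRrM.
  rewrite -!powRD ?(gt_eqF (pi_gt0 R)) ?implybT//; congr powR.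
  by rewrite natrD; field.
transitivity (Num.sqrt pi ^+ m ^+ n * (\prod_(k < n) Gamma (d + 1 + (0 + k)%:R / 2) /
   \prod_(k < n) Gamma (d + 1 + (m + k)%:R / 2))); last by field; rewrite !PG0 !pi0.
rewrite -prodf_div -[X in X * _](_ : \prod_(k < n) (Num.sqrt pi ^+ m) = _); last first.
  by rewrite prodr_const card_ord.
rewrite -big_split; apply: eq_bigr => k _ /=.
rewrite col_constE; last by rewrite (lt_le_trans d1)// lerDl divr_ge0.
rewrite add0n natrD.
have -> : d + 1 + (m%:R + k%:R) / 2 = d + 1 + k%:R / 2 + m%:R / 2 by ring.
have -> : d + k%:R / 2 + 1 = d + 1 + k%:R / 2 by ring.
by rewrite mulrA.
Qed.

End constants.

(** * Determinant powers with diagonal blocks *)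

Section diagonal.
Context {R : realType}.

Lemma posdefmx_diag n (a : 'rV[R]_n) : posdefmx (diag_mx a) <-> forall i, 0 < a 0 i.
Proof.
have quad (v : 'cV[R]_n) : (v^T *m diag_mx a *m v) 0 0 = \sum_i a 0 i * v i 0 ^+ 2.
  rewrite mul_mx_diag mxE; apply: eq_bigr => i _; rewrite !mxE; ring.
split=> [[_ pa] i|a0].
  have := pa (delta_mx i 0); rewrite quad (bigD1 i)//= mxE !eqxx expr1n mulr1.
  rewrite big1 ?addr0; last by move=> j ji; rewrite mxE (negbTE ji) expr0n mulr0.
  apply; apply/eqP => /matrixP/(_ i 0)/eqP; rewrite !mxE !eqxx.
  by rewrite oner_eq0.
split; first exact: tr_diag_mx.
move=> v v0; rewrite quad.
have [i vi0] : exists i, v i 0 != 0.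
  apply/existsP; apply: contraNT v0; rewrite negb_exists => /forallP v0.
  apply/eqP/matrixP => i j; rewrite ord1 mxE; apply/eqP.
  by have := v0 i; rewrite negbK.
rewrite (bigD1 i)//= ltr_wpDr//; last by rewrite mulr_gt0// exprn_even_gt0.
by apply: sumr_ge0 => j _; rewrite mulr_ge0 ?sqr_ge0// ltW.
Qed.

Lemma powR_prod (I : Type) (s : seq I) (f : I -> R) d : (forall i, 0 <= f i) ->
  (\prod_(i <- s) f i) `^ d = \prod_(i <- s) f i `^ d.
Proof.
move=> f0; elim: s => [|i s IH]; first by rewrite !big_nil powR1.
by rewrite !big_cons powRM ?IH// prodr_ge0.
Qed.

(** Separates the variables: the cone condition on a diagonal matrix splits into one sign condition
    per entry, carried by [ppow]. *)
Lemma pdpow_diag n (a : 'rV[R]_n) d : pdpow d (diag_mx a) = \prod_i ppow d (a 0 i).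
Proof.
have [pa|npa] := pselect (posdefmx (diag_mx a)).
  rewrite pdpowE// det_diag; move/posdefmx_diag : pa => a0.
  rewrite powR_prod; last by move=> i; exact: ltW.
  by apply: eq_bigr => i _; rewrite /ppow a0.
rewrite pdpow_npd//.
have /existsNP[i /negP] : ~ forall i, 0 < a 0 i by move/posdefmx_diag.
by rewrite -leNgt => ai; rewrite (bigD1 i)//= ppow_le0// mul0r.
Qed.

(** With a diagonal pivot, the term subtracted in the Schur complement splits into one rank-one
    matrix per column of [B]. *)
Lemma pdpow_block_diag m n (A : 'M[R]_m) (B : 'M[R]_(m, n)) (b : 'rV[R]_n) d :
  (forall j, 0 < b 0 j) ->
  pdpow d (block_mx A B B^T (diag_mx b)) =
  \prod_j b 0 j `^ d * pdpow d (A - \sum_j (b 0 j)^-1 *: (col j B *m (col j B)^T)).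
Proof.
move=> b0; have pD : posdefmx (diag_mx b) by apply/posdefmx_diag.
have uD := posdefmx_unit pD.
have -> : \sum_j (b 0 j)^-1 *: (col j B *m (col j B)^T) = B *m invmx (diag_mx b) *m B^T.
  have -> : invmx (diag_mx b) = diag_mx (\row_j (b 0 j)^-1).
    apply: (can_inj (mulKmx uD)); rewrite mulmxV// mulmx_diag -[LHS]diag_const_mx.
    by congr diag_mx; apply/rowP => j; rewrite !mxE mulfV// gt_eqF.
  apply/matrixP => i k; rewrite summxE mul_mx_diag mxE; apply: eq_bigr => j _.
  by rewrite !mxE big_ord1 !mxE; ring.
set S := A - _.
have KS : posdefmx (block_mx A B B^T (diag_mx b)) <-> posdefmx S by exact: posdefmx_schur.
have [pS|npS] := pselect (posdefmx S); last first.
  by rewrite !pdpow_npd ?mulr0// => /KS.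
rewrite !pdpowE//; last exact/KS.
rewrite det_schur_dr// powRM ?(ltW (posdefmx_det_gt0 _))// det_diag.
by rewrite powR_prod// => j; exact: ltW.
Qed.

End diagonal.

(** * The integral for the complete bipartite graph *)

Section bipartite.
Context {R : realType} (m n : nat).
Local Notation RT := (measurableTypeR R).
Local Notation I := ('I_(m + n) * 'I_(m + n))%type.
Local Notation env := (I -> RT).
Local Notation G := (complete_bipartite m n).
Implicit Types (d : R) (e : env).

Definition ucoord (i : 'I_m) : I := (lshift n i, lshift n i).
Definition vcoord (j : 'I_n) : I := (rshift m j, rshift m j).
(** The column index comes first, so that [ecoord j] enumerates one column as [iterint_cols]
    expects. *)
Definition ecoord (j : 'I_n) (i : 'I_m) : I := (lshift n i, rshift m j).

Definition diag_coords : seq I :=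
  [seq ucoord i | i <- enum 'I_m] ++ [seq vcoord j | j <- enum 'I_n].
Definition edge_coords : seq I :=
  flatten [seq [seq ecoord j i | i <- enum 'I_m] | j <- enum 'I_n].

Lemma ecoord_inj j j' i i' : ecoord j i = ecoord j' i' -> j = j' /\ i = i'.
Proof.
by move=> e; split; [exact: rshift_inj (congr1 snd e)|exact: lshift_inj (congr1 fst e)].
Qed.

Lemma mem_ucoord_edge i : ucoord i \notin edge_coords.
Proof.
apply/flattenP => -[s /mapP[j _ ->] /mapP[k _ /(congr1 snd)/eqP]] /=.
by rewrite eq_lrshift.
Qed.

Lemma mem_vcoord_edge j : vcoord j \notin edge_coords.
Proof.
apply/flattenP => -[s /mapP[k _ ->] /mapP[i _ /(congr1 fst)/eqP]] /=.
by rewrite eq_rlshift.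
Qed.

Lemma diag_coords_uniq : uniq diag_coords.
Proof.
have uI : injective ucoord by move=> i j /(congr1 fst)/lshift_inj.
have vI : injective vcoord by move=> i j /(congr1 fst)/rshift_inj.
rewrite cat_uniq (map_inj_uniq uI) (map_inj_uniq vI) !enum_uniq andbT /=.
apply/hasPn => _ /mapP[j _ ->]; apply/mapP => -[i _ /(congr1 fst)/eqP] /=.
by rewrite eq_rlshift.
Qed.

Lemma edge_coords_uniq : uniq edge_coords.
Proof.
rewrite /edge_coords (@allpairs_uniq _ _ _ ecoord) ?enum_uniq//.
by move=> [j i] [j' i'] _ _ /= /ecoord_inj[-> ->].
Qed.

Lemma coords_perm :
  perm_eq (enum (graph_coord G)) (diag_coords ++ edge_coords).
Proof.
apply: uniq_perm; first exact: enum_uniq.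
  rewrite cat_uniq diag_coords_uniq edge_coords_uniq andbT /=.
  apply/hasPn => x xe; apply/negP; rewrite mem_cat => /orP[] /mapP[k _ xk].
    by move: xe; rewrite xk (negbTE (mem_ucoord_edge _)).
  by move: xe; rewrite xk (negbTE (mem_vcoord_edge _)).
have uE i : ucoord i \in diag_coords by rewrite mem_cat map_f ?mem_enum.
have vE j : vcoord j \in diag_coords by rewrite mem_cat map_f ?orbT ?mem_enum.
have eE j i : ecoord j i \in edge_coords.
  by apply/flattenP; exists [seq ecoord j i | i <- enum 'I_m]; apply/mapP;
    [exists j | exists i]; rewrite ?mem_enum.
move=> x; rewrite mem_enum inE mem_cat; apply/idP/idP.
  case: x => i j /=; case: (split_ordP i) => i' ->; case: (split_ordP j) => j' ->.
  - rewrite /bip_edge/= !ltn_ord eqxx andbF orbF => /eqP/lshift_inj ->.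
    by rewrite -/(ucoord j') uE.
  - by rewrite -/(ecoord j' i') eE orbT.
  (* A pair with its first vertex in the second part is excluded by the order: each edge is listed
     once, smaller index first. *)
  - rewrite eq_rlshift /= => /andP[+ _]; rewrite ltnNge => /negP[].
    by rewrite (leq_trans (ltnW (ltn_ord _)))// leq_addr.
  - rewrite /bip_edge/= !ltnNge !leq_addr eqxx andbF orbF => /eqP/rshift_inj ->.
    by rewrite -/(vcoord j') vE.
move=> /orP[]; first rewrite mem_cat => /orP[] /mapP[k _ ->] /=; rewrite ?eqxx//.
move=> /flattenP[s /mapP[j _ ->] /mapP[i _ ->]] /=.
by rewrite (leq_trans (ltn_ord i) (leq_addr _ _)) /bip_edge/= ltn_ord ltnNge leq_addr orbT.
Qed.

Definition bip_mx e : 'M[R]_(m + n) :=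
  block_mx (diag_mx (\row_i e (ucoord i))) (\matrix_(i, j) (e (ecoord j i) : R))
    (\matrix_(i, j) (e (ecoord j i) : R))^T (diag_mx (\row_j e (vcoord j))).

Lemma bip_mx_sym e : (bip_mx e)^T = bip_mx e.
Proof. by rewrite tr_block_mx !tr_diag_mx trmxK. Qed.

Lemma bip_mx_measurable i j : env_real_measurable (fun e => bip_mx e i j).
Proof.
move=> disp T f mf; rewrite /bip_mx.
case: (split_ordP i) => i' ->; case: (split_ordP j) => j' ->.
- under eq_fun do rewrite block_mxEul !mxE.
  by case: (i' == j'); [exact: mf|exact: measurable_cst].
- under eq_fun do rewrite block_mxEur !mxE.
  exact: mf.
- under eq_fun do rewrite block_mxEdl !mxE.
  exact: mf.
- under eq_fun do rewrite block_mxEdr !mxE.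
  by case: (i' == j'); [exact: mf|exact: measurable_cst].
Qed.

Lemma bip_mx_graph e i j : i != j -> ~~ G i j -> bip_mx e i j = 0.
Proof.
rewrite /bip_mx /= /bip_edge negbK.
case: (split_ordP i) => i' ->; case: (split_ordP j) => j' -> /=.
- by rewrite (inj_eq (@lshift_inj _ _)) block_mxEul !mxE => /negbTE ->.
- by [].
- by [].
- by rewrite (inj_eq (@rshift_inj _ _)) block_mxEdr !mxE => /negbTE ->.
Qed.

Local Notation coords := (enum (graph_coord G)).
Local Notation N := #|graph_coord G|.
Local Notation env_of x := (@tuple_env R I N coords (fun=> 0) x).

Lemma graph_mxE (x : N.-tuple RT) : graph_mx G x = bip_mx (env_of x).
Proof.
(* Off the free coordinates both sides are 0: there [index] is the length of the tuple, and the base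
   environment is zero. *)
have nE i : nth (0 : R) x (index i coords) = env_of x i.
  rewrite /tuple_env; case: ifPn => // ic.
  by rewrite nth_default// size_tuple memNindex// -cardE.
have out i j : i != j -> ~~ G i j -> env_of x (i, j) = 0 :> R.
  move=> ij /negP nG; rewrite /tuple_env mem_enum inE; case: ifP => //.
  by move=> /orP[/eqP /= E|/andP[_ /nG]//]; rewrite E eqxx in ij.
apply/matrixP => i j; rewrite mxE nE /bip_mx.
case: (split_ordP i) => i' ->; case: (split_ordP j) => j' -> /=.
- rewrite block_mxEul !mxE; have [->|ij] := eqVneq i' j'; first by rewrite leqnn.
  have nG k l : ~~ G (lshift n k) (lshift n l) by rewrite /= /bip_edge /= !ltn_ord.
  by rewrite mulr0n; case: ifP => _; rewrite out// (inj_eq (@lshift_inj _ _))// eq_sym.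
- by rewrite (leq_trans (ltnW (ltn_ord i')) (leq_addr _ _)) block_mxEur mxE.
- rewrite leqNgt (leq_trans (ltn_ord j') (leq_addr _ _)) /= block_mxEdl mxE mxE.
  by [].
- rewrite block_mxEdr !mxE; have [->|ij] := eqVneq i' j'; first by rewrite leqnn.
  have nG k l : ~~ G (rshift m k) (rshift m l).
    by rewrite /= /bip_edge /= !ltnNge !leq_addr.
  by rewrite mulr0n; case: ifP => _; rewrite out// (inj_eq (@rshift_inj _ _))// eq_sym.
Qed.

Definition bip_integrand d e : \bar R :=
  (pdpow d (bip_mx e) * expR (- \tr (bip_mx e)))%:E.

Lemma bip_integrand_ge0 d e : (0 <= bip_integrand d e)%E.
Proof. by rewrite lee_fin mulr_ge0 ?pdpow_ge0 ?expR_ge0. Qed.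

Lemma bip_integrand_measurable d : env_measurable (bip_integrand d).
Proof.
move=> disp T f mf; apply/measurable_EFinP/measurable_funM.
  apply: measurable_pdpow => [t|i j]; first exact: bip_mx_sym.
  exact: bip_mx_measurable.
apply: measurableT_comp => //; apply: measurable_funN.
by apply: measurable_sum => i; exact: bip_mx_measurable.
Qed.

Local Notation Dset := (@graph_mx R (m + n) G @^-1` posdef_graph G).
Local Notation f d := (fun x : N.-tuple RT => (graph_integrand d 1%:M (graph_mx G x))%:E).

Lemma posdef_graphE x : Dset x <-> posdefmx (bip_mx (env_of x)).
Proof.
rewrite /posdef_graph /= graph_mxE; split => [[]//|pK]; split => // i j.
exact: bip_mx_graph.
Qed.

Lemma measurable_Dset : measurable Dset.
Proof.
rewrite (_ : Dset = (fun x => `[< posdefmx (bip_mx (env_of x)) >]) @^-1` [set true]).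
  have mp : measurable_fun [set: N.-tuple RT]
      (fun x => `[< posdefmx (bip_mx (env_of x)) >]).
    apply: measurable_posdefmx => [t|i j]; first exact: bip_mx_sym.
    exact: (bip_mx_measurable i j (coord_measurable_tuple_env coords (fun=> 0))).
  by rewrite -[X in measurable X]setTI; exact: mp.
apply/seteqP; split => x; first by move=> /posdef_graphE pK; apply/asboolP.
by move=> /asboolP pK; apply/posdef_graphE.
Qed.

(** Trades the domain of integration for the zero extension inside [pdpow]. *)
Lemma restrict_integrand d :
  (f d) \_ Dset = (fun x => bip_integrand d (env_of x)).
Proof.
apply/funext => x; rewrite patchE /bip_integrand.
case: ifPn => [/set_mem/posdef_graphE pK|/negP xD].
  by rewrite pdpowE// /graph_integrand mulmx1 graph_mxE.
by rewrite pdpow_npd ?mul0r// => pK; apply: xD; apply/mem_set/posdef_graphE.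
Qed.

(** The diagonal coordinates are placed outermost, so that the edges are integrated with [diag a]
    and [diag b] held fixed. *)
Lemma graph_integralE d :
  graph_integral G d 1%:M = iterint (diag_coords ++ edge_coords) (bip_integrand d) (fun=> 0).
Proof.
rewrite /graph_integral integral_mkcond restrict_integrand.
rewrite integral_lebesgue_tuple ?enum_uniq//; last 3 first.
- by rewrite -cardE.
- exact: bip_integrand_ge0.
- exact: bip_integrand_measurable.
apply: iterint_perm; [exact: bip_integrand_ge0|exact: bip_integrand_measurable| |].
  exact: enum_uniq.
exact: coords_perm.
Qed.

Lemma graph_integral_cvgP d : (graph_integral G d 1%:M < +oo)%E ->
  graph_integral_cvg G d 1%:M.
Proof.
move=> foo; apply/integrableP; split.
  apply/(measurable_restrictT _ measurable_Dset); rewrite restrict_integrand.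
  apply: (@bip_integrand_measurable d _ _ (fun x : N.-tuple RT => env_of x)).
  exact: coord_measurable_tuple_env.
move: foo; rewrite /graph_integral; congr (_ < _)%E; apply: eq_integral => x _.
by rewrite gee0_abs// lee_fin mulr_ge0 ?powR_ge0 ?expR_ge0.
Qed.

(** What the edge integration leaves in each diagonal variable: the exponent grows by half the
    degree of the vertex, and the final 1 offsets the [a - 1] in [gamma_kernel]. *)
Definition diag_kernel d (ij : I) : R -> R :=
  gamma_kernel (if (ij.1 < m)%N then d + n%:R / 2 + 1 else d + m%:R / 2 + 1).

Lemma prod_diag_coords (g : I -> R) : \prod_(ij <- diag_coords) g ij =
  \prod_i g (ucoord i) * \prod_j g (vcoord j).
Proof. by rewrite big_cat (big_map ucoord) (big_map vcoord) !big_enum. Qed.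

Lemma prod_diag_kernel d e :
  \prod_(ij <- diag_coords) diag_kernel d ij (e ij) =
  \prod_i gamma_kernel (d + n%:R / 2 + 1) (e (ucoord i)) *
  \prod_j gamma_kernel (d + m%:R / 2 + 1) (e (vcoord j)).
Proof.
rewrite prod_diag_coords; congr (_ * _); apply: eq_bigr => i _;
  rewrite /diag_kernel /=; first by rewrite ltn_ord.
by rewrite ltnNge leq_addr.
Qed.

Definition bip_const d : R := \prod_(k < n) col_const m (d + k%:R / 2).

Lemma pdpow_bip_mx d e : (forall j, 0 < e (vcoord j)) ->
  pdpow d (bip_mx e) = \prod_j (e (vcoord j) : R) `^ d *
    pdpow d (diag_mx (\row_i (e (ucoord i) : R)) - \sum_(j <- enum 'I_n)
      (e (vcoord j))^-1 *: (colv (ecoord j) e *m (colv (ecoord j) e)^T)).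
Proof.
move=> b0; rewrite /bip_mx pdpow_block_diag; last by move=> j; rewrite mxE.
rewrite big_enum (eq_bigr (fun j => (e (vcoord j) : R) `^ d)); last by move=> j _; rewrite mxE.
apply: (congr1 (fun M => _ * pdpow d (diag_mx (\row_i (e (ucoord i) : R)) - M))).
apply: eq_bigr => j _.
have -> : col j (\matrix_(i, j0) (e (ecoord j0 i) : R)) = colv (ecoord j) e.
  by apply/matrixP => i k; rewrite !mxE.
by rewrite mxE.
Qed.

Lemma expR_tr_bip_mx e : expR (- \tr (bip_mx e)) =
  \prod_i expR (- (e (ucoord i) : R)) * \prod_j expR (- (e (vcoord j) : R)).
Proof.
rewrite mxtrace_block !mxtrace_diag opprD expRD -!sumrN !expR_sum.
by congr (_ * _); apply: eq_bigr => i _; rewrite mxE.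
Qed.

Lemma gamma_kernelE a t : 0 < t -> gamma_kernel a t = t `^ (a - 1) * expR (- t) :> R.
Proof. by rewrite /gamma_kernel /ppow => ->. Qed.

(** Factors depending on the diagonal alone come out as the constant [c], and [iterint_cols] with
    the matrix [diag_mx a] integrates the columns. *)
Lemma iterint_edges d e : -1 < d ->
  iterint edge_coords (bip_integrand d) e =
  (bip_const d * \prod_(ij <- diag_coords) diag_kernel d ij (e ij))%:E.
Proof.
move=> d1; rewrite prod_diag_kernel.
have eqd e' : (forall i, i \notin edge_coords -> e' i = e i) ->
    (forall i, e' (ucoord i) = e (ucoord i)) * (forall j, e' (vcoord j) = e (vcoord j)).
  by move=> e'E; split=> k; apply: e'E; [exact: mem_ucoord_edge|exact: mem_vcoord_edge].
(* If some [vcoord] entry is not positive, the matrix is never in the cone and the corresponding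
   Gamma kernel is zero. *)
have [b0|/existsNP[j /negP]] := pselect (forall j, 0 < (e (vcoord j) : R)); last first.
  rewrite -leNgt => bj; rewrite (bigD1 (P := xpredT) (F := fun j => gamma_kernel _ _) j)//=.
  rewrite /gamma_kernel [X in X * expR _ * _](ppow_le0 _ bj) !mul0r !mulr0.
  have -> : iterint edge_coords (bip_integrand d) e = iterint edge_coords (fun=> 0%:E) e.
    apply: iterint_ext => e' /eqd[_ vE]; rewrite /bip_integrand pdpow_npd ?mul0r//.
    by move/posdefmx_drsub; rewrite block_mxKdr => /posdefmx_diag/(_ j);
      rewrite mxE vE ltNge bj.
  exact: iterint0.
pose a : 'rV[R]_m := \row_i (e (ucoord i) : R).
pose c := \prod_j (e (vcoord j) : R) `^ d *
  (\prod_i expR (- (e (ucoord i) : R)) * \prod_j expR (- (e (vcoord j) : R))).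
have c0 : 0 <= c.
  rewrite !mulr_ge0// prodr_ge0// => k _; rewrite ?powR_ge0 ?expR_ge0//.
pose F (e' : env) := (pdpow d (diag_mx a - \sum_(j <- enum 'I_n)
  (e (vcoord j))^-1 *: (colv (ecoord j) e' *m (colv (ecoord j) e')^T)))%:E.
transitivity (iterint edge_coords (fun e' => c%:E * F e')%E e).
  apply: iterint_ext => e' /eqd[uE vE].
  rewrite /bip_integrand expR_tr_bip_mx pdpow_bip_mx; last by move=> j; rewrite vE.
  rewrite /F -EFinM /c; congr EFin.
  have -> : (\row_i (e' (ucoord i) : R)) = a by apply/rowP => i; rewrite !mxE uE.
  have -> : \prod_j (e' (vcoord j) : R) `^ d = \prod_j (e (vcoord j) : R) `^ d.
    by apply: eq_bigr => j _; rewrite vE.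
  have -> : \prod_i expR (- (e' (ucoord i) : R)) = \prod_i expR (- (e (ucoord i) : R)).
    by apply: eq_bigr => i _; rewrite uE.
  have -> : \prod_j expR (- (e' (vcoord j) : R)) = \prod_j expR (- (e (vcoord j) : R)).
    by apply: eq_bigr => j _; rewrite vE.
  have -> : \sum_(j <- enum 'I_n)
      (e' (vcoord j))^-1 *: (colv (ecoord j) e' *m (colv (ecoord j) e')^T)
    = \sum_(j <- enum 'I_n) (e (vcoord j))^-1 *: (colv (ecoord j) e' *m (colv (ecoord j) e')^T).
    by apply: eq_bigr => j _; rewrite vE.
  by rewrite mulrAC.
rewrite iterintZl//; last 2 first.
- by move=> e'; rewrite lee_fin pdpow_ge0.
- apply: env_measurable_pdpow => [e'|i k disp T f mf].
    rewrite linearB/= tr_diag_mx linear_sum/=; congr (_ - _); apply: eq_bigr => j _.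
    by rewrite linearZ/= trmx_mul trmxK.
  under eq_fun do rewrite mxE [X in _ + X]mxE summxE.
  apply: measurable_funB; first exact: measurable_cst.
  apply: measurable_sum => j; under eq_fun do rewrite mxE.
  by apply: measurable_funM; [exact: measurable_cst|exact: colv_measurable].
have IC := @iterint_cols R _ _ m ecoord (enum 'I_n) (fun j => e (vcoord j) : R)
  (diag_mx a) d e ecoord_inj (enum_uniq _) (tr_diag_mx _) (fun j _ => b0 j) d1.
apply: (etrans (congr1 (fun z => c%:E * z)%E IC)).
rewrite -EFinM size_enum_ord big_enum pdpow_diag; congr EFin.
rewrite -/(bip_const d) /c.
have -> : \prod_j gamma_kernel (d + m%:R / 2 + 1) (e (vcoord j)) =
    \prod_j (e (vcoord j) : R) `^ d * \prod_j (e (vcoord j) : R) `^ (m%:R / 2) *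
    \prod_j expR (- (e (vcoord j) : R)).
  rewrite -!big_split; apply: eq_bigr => j _ /=.
  by rewrite gamma_kernelE// addrK powRD// (gt_eqF (b0 j)) implybT.
have -> : \prod_i gamma_kernel (d + n%:R / 2 + 1) (e (ucoord i)) =
    \prod_i ppow (d + n%:R / 2) (a 0 i) * \prod_i expR (- (e (ucoord i) : R)).
  rewrite -!big_split; apply: eq_bigr => i _ /=.
  by rewrite mxE /gamma_kernel addrK.
by ring.
Qed.

(** After the edges, the integrand is a product of functions of one diagonal variable each, so the
    integral is a product of Gamma values. *)
Lemma graph_integral_bip d : -1 < d ->
  graph_integral G d 1%:M = (Gamma (d + n%:R / 2 + 1) ^+ m *
    Gamma (d + m%:R / 2 + 1) ^+ n * bip_const d)%:E.
Proof.
move=> d1; rewrite graph_integralE iterint_cat.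
have C0 : 0 <= bip_const d.
  apply: prodr_ge0 => k _; apply: col_const_ge0.
  by rewrite (lt_le_trans d1)// lerDl divr_ge0.
pose c (ij : I) : R := Gamma (if (ij.1 < m)%N then d + n%:R / 2 + 1 else d + m%:R / 2 + 1).
have mK ij : measurable_fun [set: RT] (diag_kernel d ij) by exact: measurable_gamma_kernel.
transitivity (iterint diag_coords (fun e => (bip_const d)%:E *
    (\prod_(ij <- diag_coords) diag_kernel d ij (e ij))%:E)%E (fun=> 0)).
  by apply: iterint_ext => e _; rewrite iterint_edges.
have K0 ij x : 0 <= diag_kernel d ij x by exact: gamma_kernel_ge0.
rewrite iterintZl//; last 2 first.
- by move=> e; rewrite lee_fin prodr_ge0.
- move=> disp T f mf; apply/measurable_EFinP; apply: measurable_prod => ij _.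
  exact: (measurableT_comp (mK ij) (mf ij)).
rewrite (iterint_prod _ (c := c) diag_coords_uniq K0 mK); last first.
  move=> ij _; apply: integral_gamma_kernel.
  have q0 k : 0 <= k%:R / 2 :> R by rewrite divr_ge0.
  by case: ifP => _; have := q0 n; have := q0 m; lra.
rewrite -EFinM prod_diag_coords mulrC; congr (_ * _ * _)%:E.
  rewrite (eq_bigr (fun=> Gamma (d + n%:R / 2 + 1))); last first.
    by move=> i _; rewrite /c /= ltn_ord.
  by rewrite prodr_const card_ord.
rewrite (eq_bigr (fun=> Gamma (d + m%:R / 2 + 1))); last first.
  by move=> i _; rewrite /c /= ltnNge leq_addr.
by rewrite prodr_const card_ord.
Qed.

End bipartite.

Theorem proposition2p1 (R : realType) (m n : nat) (hm : (0 < m)%N)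
    (hn : (0 < n)%N) (delta : R) (hdelta : -1 < delta) :
  graph_integral_cvg (complete_bipartite m n) delta 1%:M /\
  graph_integral (complete_bipartite m n) delta 1%:M =
    (Gamma (delta + n%:R / 2 + 1) ^+ m * Gamma (delta + m%:R / 2 + 1) ^+ n *
     (multi_Gamma (m + n) (delta + (m + n + 1)%:R / 2) /
      (multi_Gamma m (delta + (m + n + 1)%:R / 2) *
       multi_Gamma n (delta + (m + n + 1)%:R / 2))))%:E.
Proof.
rewrite -(col_const_prod m n hdelta) -/(bip_const m n delta).
have E := graph_integral_bip m n hdelta.
(* The integrand is non-negative, so the finite value just computed already gives absolute
   convergence. *)
by split=> //; apply: graph_integral_cvgP; rewrite E ltry.
Qed.
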